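(* Let $p$ be an odd prime and let $G$ be a finite $2$-generator $p$-group of nilpotency class two. Then $G$ is $2$-capable if and only if $G$ is isomorphic to exactly one of the following $p$-groups: (i) $G_1=\langle a,b \mid [a,b]^{p^{\alpha}}=a^{p^{\alpha}}=b^{p^{\alpha}}=[a,b,b]=[a,b,a]=1\rangle$, where $\alpha\ge 1$; (ii) $G_2=\langle a,b \mid [a,b]^{p^{\gamma}}=a^{p^{\alpha}}=b^{p^{\alpha}}=[a,b,b]=[a,b,a]=1\rangle$, where $\alpha>\gamma\ge 1$; (iii) $G_3=\langle a,b \mid [a,b]^{p^{\gamma}}=a^{p^{\alpha}}=[a,b,b]=[a,b,a]=1,\ b^{p^{\beta}}=[a,b]^{p^{\sigma}}\rangle$, where $\alpha\ge\beta\ge\gamma\ge 1$, $\alpha-\beta=\gamma-\sigma$ and $0\le\sigma<\gamma$.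
   Context: Commutators are left-normed: $[x,y,z]=[[x,y],z]$. A group $G$ is $c$-capable ($c\ge1$) if $G\cong H/Z_c(H)$ for some group $H$, where $Z_c(H)$ is the $c$-th term of the upper central series of $H$. Class two means nilpotency class exactly two. *)

(* Defs.v *)
From HB Require Import structures.
From mathcomp Require Import all_boot all_fingroup all_solvable.
From mathcomp Require Import boolp.

Set Implicit Arguments.
Unset Strict Implicit.
Unset Printing Implicit Defensive.

Local Open Scope group_scope.
Local Open Scope quotient_scope.

Local Notation qrepr := generic_quotient.repr.

(* Groups that need not be finite are elements of groupType. An element x lies
   in Z_{n+1}(H), the preimage of Z(H / Z_n(H)), iff [x, y] lies in Z_n(H) for
   every y. *)
Fixpoint upper_central (H : groupType) (n : nat) (x : H) : Prop :=
  if n is m.+1 then forall y : H, upper_central m [~ x, y] else x = 1.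
Arguments upper_central {H} n x.

Section UpperCentralTheory.
Variable H : groupType.
Implicit Types (n : nat) (x y z : H).

Lemma upper_central_normal n :
  [/\ upper_central n (1 : H),
      forall x y, upper_central n x -> upper_central n y ->
        upper_central n (x * y),
      forall x, upper_central n x -> upper_central n x^-1
    & forall x z, upper_central n x -> upper_central n (x ^ z)].
Proof.
elim: n => [|n [Z1 ZM ZV ZJ]] /=.
  split=> // [x y -> ->|x ->|x z ->]; first by rewrite mulg1.
    by rewrite invg1.
  by rewrite conj1g.
split=> [y|x y Zx Zy z|x Zx y|x z Zx y].
- by rewrite comm1g.
- have -> : [~ x * y, z] = [~ x, z] ^ y * [~ y, z].
    by rewrite /commg /conjg !invgM !mulgA !mulgK.
  by apply: ZM => //; apply: ZJ.
- have -> : [~ x^-1, y] = ([~ x, y]^-1) ^ x^-1.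
    by rewrite /commg /conjg !invgM !invgK !mulgA mulgK.
  by apply/ZJ/ZV.
have -> : [~ x ^ z, y] = [~ x, y ^ z^-1] ^ z.
  by rewrite conjRg -conjgM mulVg conjg1.
exact: ZJ.
Qed.

Lemma upper_central1 n : upper_central n (1 : H).
Proof. by case: (upper_central_normal n). Qed.

Lemma upper_centralM n x y :
  upper_central n x -> upper_central n y -> upper_central n (x * y).
Proof. by case: (upper_central_normal n) => _ ZM _ _; apply: ZM. Qed.

Lemma upper_centralV n x : upper_central n x -> upper_central n x^-1.
Proof. by case: (upper_central_normal n) => _ _ ZV _; apply: ZV. Qed.

Lemma upper_centralJ n x z : upper_central n x -> upper_central n (x ^ z).
Proof. by case: (upper_central_normal n) => _ _ _ ZJ; apply: ZJ. Qed.

End UpperCentralTheory.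

Section UpperCentralQuotient.
Variables (H : groupType) (c : nat).
Implicit Types x y : H.

Definition uc_rel x y : bool := `[< upper_central c (x^-1 * y) >].

Lemma uc_rel_equiv : equiv_class_of uc_rel.
Proof.
split=> [x|x y|y x z].
- by apply/asboolP; rewrite mulVg; apply: upper_central1.
- have sym u v : uc_rel u v -> uc_rel v u.
    move/asboolP/upper_centralV=> Zuv; apply/asboolP.
    by rewrite invgM invgK in Zuv.
  by apply/idP/idP; apply: sym.
move=> /asboolP Zxy /asboolP Zyz; apply/asboolP.
by have := upper_centralM Zxy Zyz; rewrite mulgA mulgK.
Qed.

Canonical uc_equiv := EquivRelPack uc_rel_equiv.

(* The group H / Z_c(H). *)
Definition uc_quot := {eq_quot uc_equiv}.

HB.instance Definition _ : EqQuotient H uc_equiv uc_quot := EqQuotient.on uc_quot.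
HB.instance Definition _ := Choice.on uc_quot.

Implicit Types A B C : uc_quot.

Definition uc_pi (x : H) : uc_quot := \pi_uc_quot x.
Definition uc_one : uc_quot := uc_pi 1.
Definition uc_mul A B : uc_quot := uc_pi (qrepr A * qrepr B).
Definition uc_inv A : uc_quot := uc_pi (qrepr A)^-1.

Lemma uc_piP x y : uc_pi x = uc_pi y <-> upper_central c (x^-1 * y).
Proof.
split=> [/eqmodP/asboolP //|Zxy].
by apply/eqmodP/asboolP.
Qed.

Lemma uc_reprK A : uc_pi (qrepr A) = A.
Proof. exact: reprK. Qed.

Lemma uc_piM x y : uc_mul (uc_pi x) (uc_pi y) = uc_pi (x * y).
Proof.
have /uc_piP Zx := uc_reprK (uc_pi x); have /uc_piP Zy := uc_reprK (uc_pi y).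
apply/uc_piP; set x' := qrepr _ in Zx *; set y' := qrepr _ in Zy *.
have -> : (x' * y')^-1 * (x * y) = (x'^-1 * x) ^ y' * (y'^-1 * y).
  by rewrite /conjg invgM !mulgA mulgK.
by apply: upper_centralM => //; apply: upper_centralJ.
Qed.

Lemma uc_piV x : uc_inv (uc_pi x) = uc_pi x^-1.
Proof.
have /uc_piP Zx := uc_reprK (uc_pi x); apply/uc_piP.
move: (qrepr _) Zx => x' Zx.
have -> : x'^-1^-1 * x^-1 = ((x'^-1 * x)^-1) ^ x'^-1.
  by rewrite /conjg invgM !invgK !mulgA mulgK.
exact/upper_centralJ/upper_centralV.
Qed.

Lemma uc_mulA : associative uc_mul.
Proof.
move=> A B C; rewrite -(uc_reprK A) -(uc_reprK B) -(uc_reprK C).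
by rewrite !uc_piM mulgA.
Qed.

Lemma uc_mul1 : left_id uc_one uc_mul.
Proof. by move=> A; rewrite -(uc_reprK A) uc_piM mul1g. Qed.

Lemma uc_mulr1 : right_id uc_one uc_mul.
Proof. by move=> A; rewrite -(uc_reprK A) uc_piM mulg1. Qed.

Lemma uc_mulV : left_inverse uc_one uc_inv uc_mul.
Proof. by move=> A; rewrite -(uc_reprK A) uc_piV uc_piM mulVg. Qed.

Lemma uc_mulrV : right_inverse uc_one uc_inv uc_mul.
Proof. by move=> A; rewrite -(uc_reprK A) uc_piV uc_piM mulgV. Qed.

HB.instance Definition _ :=
  isGroup.Build uc_quot uc_mulA uc_mul1 uc_mulr1 uc_mulV uc_mulrV.

End UpperCentralQuotient.

(* G is isomorphic to H / Z_c(H) for some group H, which may be infinite. *)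
Definition capable (c : nat) (gT : finGroupType) (G : {group gT}) : Prop :=
  exists (H : groupType) (f : {multiplicative uc_quot H c -> [subg G]}),
    bijective f.

Definition two_generated (gT : finGroupType) (G : {group gT}) : Prop :=
  exists a b : gT, <<[set a; b]>> = G.

(* The members of the list, family by family. *)
Inductive member :=
  | G1 of nat                 (* alpha *)
  | G2 of nat & nat           (* alpha, gamma *)
  | G3 of nat & nat & nat & nat. (* alpha, beta, gamma, sigma *)

(* alpha - beta = gamma - sigma is between natural numbers, but the other
   conditions make both subtractions exact. *)
Definition admissible (m : member) : bool :=
  match m with
  | G1 alpha => 1 <= alpha
  | G2 alpha gamma => (gamma < alpha) && (1 <= gamma)
  | G3 alpha beta gamma sigma =>
      [&& beta <= alpha, gamma <= beta, 1 <= gamma,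
          alpha - beta == gamma - sigma & sigma < gamma]
  end.

(* The groups presented below are finite, so that \isog Grp, which compares G
   with the largest finite quotient, does say that G is the presented group. *)
Definition isog_member (p : nat) (gT : finGroupType) (G : {group gT})
    (m : member) : Prop :=
  match m with
  | G1 alpha =>
      G \isog Grp (a : b :
        [~ a, b] ^+ (p ^ alpha) = 1, a ^+ (p ^ alpha) = 1,
        b ^+ (p ^ alpha) = 1, [~ a, b, b] = 1, [~ a, b, a] = 1)
  | G2 alpha gamma =>
      G \isog Grp (a : b :
        [~ a, b] ^+ (p ^ gamma) = 1, a ^+ (p ^ alpha) = 1,
        b ^+ (p ^ alpha) = 1, [~ a, b, b] = 1, [~ a, b, a] = 1)
  | G3 alpha beta gamma sigma =>
      G \isog Grp (a : b :
        [~ a, b] ^+ (p ^ gamma) = 1, a ^+ (p ^ alpha) = 1,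
        [~ a, b, b] = 1, [~ a, b, a] = 1,
        b ^+ (p ^ beta) = [~ a, b] ^+ (p ^ sigma))
  end.

(* Main.v *)
Require Import Defs.
From HB Require Import structures.
From mathcomp Require Import all_boot ssralg zmodp ring all_fingroup all_solvable.

Set Implicit Arguments.
Unset Strict Implicit.
Unset Printing Implicit Defensive.

Local Open Scope group_scope.

(** Suppose [G] is [H / Z_2(H)] and is generated by the images of [x] and [y].
    With [c = [~ x, y]], [u = [~ c, x]] and [v = [~ c, y]], the commutators of
    [[~ x ^+ n, y]] with [x] and [y] are [u ^+ n * [~ u, x] ^+ 'C(n, 2)] and
    [v ^+ n * [~ u, y] ^+ 'C(n, 2)].  For odd [n] it follows that [x ^+ n] lies
    in [Z_2(H)] iff both [u ^+ n] and [v ^+ n] are trivial, a condition that is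
    symmetric in [x] and [y].  So any two elements generating [G] have the same
    order.  Applied to generators adapted to a decomposition of [G / G'], this
    forces the relations of the list.

    Conversely a listed group is [W ><| <[a]>] with [W = <[[~ a, b]]> <*> <[b]>]
    abelian and [#[a] = #[b]] equal to the exponent.  Let [T] be the automorphism
    [(j, k, w) |-> (j, k * j, k * w ^ a)] of [W ^ 3], and put [N = T - 1].  Then
    [T ^+ i * u |-> a ^+ i * N (N u)] is a morphism from [W ^ 3 ><| <[T]>] onto
    [G] whose kernel is the second centre. *)

(** * Orders of generators of a 2-capable group *)

(** This comes from [2 * 'C(n, 2) = n * (n - 1)], as the odd [m] is prime to 2. *)
Lemma dvdn_bin2 m n : odd m -> m %| n -> m %| 'C(n, 2).
Proof.
move=> odd_m dv_mn; rewrite -(@Gauss_dvdr _ 2) ?coprimen2 //.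
by rewrite -[2 in X in _ %| X]/(2`!) mulnC bin_ffact ffactnSr ffactn1 dvdn_mulr.
Qed.

(** * Commutator calculus around the second centre *)

Section GroupTypeCommutators.

Variable H : groupType.
Implicit Types g h x y z : H.

Lemma mulg_commJ x y z : [~ x * y, z] = [~ x, z] ^ y * [~ y, z].
Proof. by rewrite !commgEr conjgM mulgA -conjMg mulgK. Qed.

Lemma commg_mulJ x y z : [~ x, y * z] = [~ x, z] * [~ x, y] ^ z.
Proof. by rewrite !commgEl conjgM -mulgA -conjMg mulKVg. Qed.

Lemma commg_VJ x y : [~ x^-1, y] = ([~ x, y]^-1) ^ x^-1.
Proof. by rewrite /commg /conjg !invgM !invgK !mulgA mulgK. Qed.

Lemma conjg_commute x y : commute x y -> x ^ y = x.
Proof. by move=> cxy; apply/conjg_fixP/commgP. Qed.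

Lemma conjg_mul_comm x y : x ^ y = x * [~ x, y].
Proof. by rewrite mulKVg. Qed.

Lemma upper_central2P z : upper_central 2 z <-> forall g h, commute [~ z, g] h.
Proof. by split=> Zz g h; [apply/commgP/eqP/Zz | apply/eqP/commgP]. Qed.

Section SecondCentre.

Variable z : H.
Hypothesis Z2z : upper_central 2 z.

Let central g h : commute [~ z, g] h.
Proof. by have /upper_central2P := Z2z; apply. Qed.

Lemma upper_central2_commM g h : [~ z, g * h] = [~ z, g] * [~ z, h].
Proof. by rewrite commg_mulJ (conjg_commute (central g h)) central. Qed.

Lemma upper_central2_commX n g : [~ z ^+ n, g] = [~ z, g] ^+ n.
Proof.
elim: n => [|n IHn]; first by rewrite comm1g.
by rewrite !expgS mulg_commJ (conjg_commute (central g _)) IHn.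
Qed.

Lemma upper_central2_commV g : [~ z^-1, g] = [~ z, g]^-1.
Proof.
apply: (mulIg [~ z, g]).
rewrite mulVg -{1}(conjg_commute (central g z^-1)).
have := mulg_commJ z z^-1 g; rewrite mulgV comm1g => /esym eq1.
have cz: commute ([~ z, g] ^ z^-1) [~ z^-1, g].
  by rewrite (conjg_commute (central _ _)); apply: central.
by rewrite -cz.
Qed.

(* [g |-> [~ z, g]] is a morphism to the centre, so it kills commutators. *)
Lemma upper_central2_commute x y : commute z [~ x, y].
Proof.
apply/commgP/eqP; have := commgC x y.
move/(congr1 (fun t => [~ z, t])); rewrite !upper_central2_commM.
rewrite [in LHS](central x _ : _ * _ = _) => eq1.
by apply: (mulgI ([~ z, y] * [~ z, x])); rewrite -eq1 mulg1.
Qed.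

End SecondCentre.

(** Induction through [[~ x ^+ n.+1, y] = [~ x ^+ n, y] ^ x * c]: conjugation by [x] turns [u] into
    [u * r] with [r] central, which adds [n] to the exponent of [r]. *)
Lemma commXg_comml (x y : H) n :
    (forall w, upper_central 2 [~ x, y, w]) ->
  [~ x ^+ n, y, x] = [~ x, y, x] ^+ n * [~ x, y, x, x] ^+ 'C(n, 2).
Proof.
move=> xy3; set c := [~ x, y]; set u := [~ c, x]; set r := [~ u, x].
have cr g : commute r g by have /upper_central2P := xy3 x; apply.
have cuc : commute u c by apply/upper_central2_commute/xy3.
elim: n => [|n IHn]; first by rewrite !comm1g mulg1.
have -> : [~ x ^+ n.+1, y] = [~ x ^+ n, y] ^ x * c by rewrite expgSr mulg_commJ.
have -> : [~ [~ x ^+ n, y] ^ x * c, x] = ([~ x ^+ n, y, x] ^ x) ^ c * u.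
  by rewrite mulg_commJ (conjRg _ x x) (conjg_commute (commute_refl x)).
rewrite IHn.
have -> : (u ^+ n * r ^+ 'C(n, 2)) ^ x = u ^+ n * r ^+ n * r ^+ 'C(n, 2).
  rewrite (conjMg (u ^+ n)) !conjXg (conjg_commute (cr x)) (conjg_mul_comm u).
  by rewrite expgMn //; apply/commute_sym.
rewrite conjg_commute; last first.
  apply/commute_sym/commuteM; first apply/commuteM.
  - exact/commuteX/commute_sym.
  - exact/commuteX/commute_sym.
  - exact/commuteX/commute_sym.
rewrite binS bin1 expgSr addnC -!(mulgA (u ^+ n)) -expgnDr; congr (_ * _).
exact/commute_sym/commuteX/commute_sym.
Qed.

(** The same recursion, with [[~ x ^+ n, y] ^ x] split as [[~ x ^+ n, y] * [~ x ^+ n, y, x]]. By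
    [commXg_comml] and the centrality of [r], the commutator of the second factor with [y] is
    [s ^+ n]. *)
Lemma commXg_commr (x y : H) n :
    (forall w, upper_central 2 [~ x, y, w]) ->
  [~ x ^+ n, y, y] = [~ x, y, y] ^+ n * [~ x, y, x, y] ^+ 'C(n, 2).
Proof.
move=> xy3; elim: n => [|n IHn]; first by rewrite !comm1g mulg1.
have := commXg_comml n xy3; move: IHn.
set c := [~ x, y]; set u := [~ c, x]; set r := [~ u, x].
set v := [~ c, y]; set s := [~ u, y] => IHn IHx.
have cr g : commute r g by have /upper_central2P := xy3 x; apply.
have cs g : commute s g by have /upper_central2P := xy3 x; apply.
have cvc a b : commute v [~ a, b] by apply/upper_central2_commute/xy3.
have -> : [~ x ^+ n.+1, y] = [~ x ^+ n, y] ^ x * c by rewrite expgSr mulg_commJ.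
have -> : [~ [~ x ^+ n, y] ^ x * c, y]
    = ([~ x ^+ n, y, y] ^ [~ x ^+ n, y, x] * [~ x ^+ n, y, x, y]) ^ c * v.
  by rewrite mulg_commJ (conjg_mul_comm _ x) (mulg_commJ [~ x ^+ n, y]).
rewrite IHn IHx.
have -> : [~ u ^+ n * r ^+ 'C(n, 2), y] = s ^+ n.
  rewrite mulg_commJ (upper_central2_commX (xy3 x)) -/s.
  rewrite (conjg_commute (commute_sym (commuteX _ (commute_sym (cs _))))).
  suff /commgP/eqP -> : commute (r ^+ 'C(n, 2)) y by rewrite mulg1.
  exact/commute_sym/commuteX/commute_sym/cr.
rewrite (@conjg_commute (v ^+ n * s ^+ 'C(n, 2))); last first.
  apply/commute_sym/commuteM; last exact/commuteX/commute_sym/cs.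
  by apply/commuteX/commute_sym/commuteM; apply/commuteX; [apply: cvc|apply/commute_sym].
have -> : (v ^+ n * s ^+ 'C(n, 2) * s ^+ n) ^ c * v
    = v ^+ n.+1 * s ^+ ('C(n, 2) + n).
  rewrite -(mulgA (v ^+ n)) -expgnDr conjg_commute; last first.
    apply/commute_sym/commuteM; last exact/commuteX/commute_sym/cs.
    exact/commuteX/commute_sym/cvc.
  rewrite expgSr -!(mulgA (v ^+ n)); congr (_ * _).
  exact/commute_sym/commuteX/commute_sym.
by rewrite binS bin1 addnC.
Qed.

(* The induction principle says that [x], [y] and [Z_2(H)] generate [H]; closure
   under products suffices because [H / Z_2(H)] will be finite. *)
Lemma upper_central2_swap (x y : H) n : odd n ->
    (forall P : H -> Prop, P x -> P y -> (forall z, upper_central 2 z -> P z) ->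
       (forall g h, P g -> P h -> P (g * h)) -> forall h, P h) ->
    (forall w, upper_central 2 [~ x, y, w]) ->
  upper_central 2 (x ^+ n) -> upper_central 2 (y ^+ n).
Proof.
move=> odd_n genH xy3 Zxn.
have yx1 w : [~ y, x, w] = [~ x, y, w]^-1.
  rewrite -(invgR x y) commg_VJ conjg_commute //.
  exact/commuteV/commute_sym/commuteV/commute_sym/upper_central2_commute/xy3.
have yx3 w : upper_central 2 [~ y, x, w].
  by rewrite yx1; apply/upper_centralV/xy3.
have /upper_central2P cxn := Zxn.
have cX w : [~ x ^+ n, y, w] = 1 by apply/eqP/commgP/cxn.
have := commXg_commr n xy3; have := commXg_comml n xy3.
have := commXg_commr n yx3; have := commXg_comml n yx3.
rewrite !cX !yx1 !upper_central2_commV //.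
set u := [~ x, y, x]; set v := [~ x, y, y]; set m := 'C(n, 2).
move=> Ex Ey /esym Eu /esym Ev.
have ZC z g h : upper_central 2 z -> commute [~ z, g] h.
  by move=> /upper_central2P; apply.
(* Taking commutators with [h] in [z ^+ n * e ^+ m = 1] removes the central [e]. *)
have comm_n z e h : upper_central 2 z -> (forall g, commute e g) ->
    z ^+ n * e ^+ m = 1 -> [~ z, h] ^+ n = 1.
  move=> Zz Ze E; have := congr1 (fun t => [~ t, h]) E.
  rewrite comm1g mulg_commJ.
  have /commgP/eqP -> : commute (e ^+ m) h by apply/commute_sym/commuteX/commute_sym.
  rewrite mulg1 conjg_commute ?upper_central2_commX //.
  exact/commuteX/commute_sym.
have u1 g : [~ u, g] ^+ n = 1.
  by apply: (comm_n u [~ u, x]) => // [|h]; [apply: xy3 | apply/ZC/xy3].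
have v1 g : [~ v, g] ^+ n = 1.
  by apply: (comm_n v [~ u, y]) => // [|h]; [apply: xy3 | apply/ZC/xy3].
(* Oddness of [n] enters here: [n] divides [m], so the correction factors, whose [n]-th powers are
   trivial, vanish and leave [u ^+ n = v ^+ n = 1]. *)
have [k m_def]: exists k, m = (n * k)%N.
  by have /dvdnP[k] := dvdn_bin2 odd_n (dvdnn n); rewrite mulnC; exists k.
have expm1 z : z ^+ n = 1 -> z ^+ m = 1.
  by rewrite m_def expgnA => ->; rewrite expg1n.
have un1 : u ^+ n = 1 by rewrite (expm1 _ (u1 x)) mulg1 in Eu.
have vn1 : v ^+ n = 1 by rewrite (expm1 _ (u1 y)) mulg1 in Ev.
(* Up to inversion the same [u] and [v] govern [y ^+ n], so [[~ y ^+ n, x]] commutes with [x] and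
   [y]. Like every commutator it also commutes with the second centre, hence it is central. *)
have {}Ex : [~ y ^+ n, x, y] = 1.
  by rewrite Ex expVgn vn1 expVgn (expm1 _ (v1 y)) !invg1 mulg1.
have {}Ey : [~ y ^+ n, x, x] = 1.
  by rewrite Ey expVgn un1 expVgn (expm1 _ (v1 x)) !invg1 mulg1.
have cyx : forall h, commute [~ y ^+ n, x] h.
  apply: genH => [||z Zz|g h]; [exact/commgP/eqP|exact/commgP/eqP| |exact: commuteM].
  exact/commute_sym/upper_central2_commute.
apply: genH => [h||z Zz h|g h Cg Ch w].
- exact/eqP/commgP.
- have /commgP/eqP -> : commute (y ^+ n) y by apply/commute_sym/commuteX.
  exact: comm1g.
- by apply/eqP/commgP; rewrite -invgR; apply/commute_sym/commuteV/commute_sym/ZC.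
have {}Cg v' : commute [~ y ^+ n, g] v' by apply/commgP/eqP.
have {}Ch v' : commute [~ y ^+ n, h] v' by apply/commgP/eqP.
apply/eqP/commgP; rewrite commg_mulJ conjg_commute //.
by apply/commute_sym/commuteM/commute_sym; first exact/commute_sym.
Qed.

End GroupTypeCommutators.

(** * Equal orders of the two generators *)

Section CapableToOrders.

Variables (gT : finGroupType) (G : {group gT}).

(** Trades the quotient type for an epimorphism [F] from [H] onto [G] with kernel [Z_c(H)], so that
    later arguments compute in [H]. *)
Lemma capable_lift c : capable c G ->
  exists (H : groupType) (F : H -> gT),
    [/\ {morph F : x y / x * y}, forall h, F h \in G,
        forall g, g \in G -> exists h, F h = g
      & forall h, F h = 1 <-> upper_central c h].
Proof.
case=> H [f [f' fK f'K]]; exists H, (fun h => sgval (f (uc_pi c h))).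
have fM x y : f (uc_pi c (x * y)) = f (uc_pi c x) * f (uc_pi c y).
  by rewrite -uc_piM; apply: gmulfM.
have f1 : f (uc_pi c 1) = 1.
  by apply: (mulgI (f (uc_pi c 1))); rewrite -fM !mulg1.
split=> [x y|h|g Gg|h]; first by rewrite fM.
- exact: subgP.
- exists (generic_quotient.repr (f' (subg G g))).
  by rewrite uc_reprK f'K subgK.
rewrite -[upper_central c h](_ : upper_central c (1^-1 * h) = _).
  rewrite -uc_piP; split=> [f_h1|<-]; last by rewrite f1.
  apply/(can_inj fK)/val_inj; rewrite f1; exact/esym.
by rewrite invg1 mul1g.
Qed.

Hypothesis G_class2 : G^`(1) \subset 'Z(G).

(** Lift [a] and [b] to [x] and [y]. Since commutators are central in [G], every [[~ x, y, w]] lies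
    in the kernel [Z_2(H)], and [upper_central2_swap] applies. *)
Lemma capable2_expg1 a b n : capable 2 G -> <<[set a; b]>> = G -> odd n ->
  a ^+ n = 1 -> b ^+ n = 1.
Proof.
case/capable_lift=> H [F [FM FG F_onto kerF]] genG odd_n an1.
have [|x Fx] := F_onto a; first by rewrite -genG mem_gen ?set21.
have [|y Fy] := F_onto b; first by rewrite -genG mem_gen ?set22.
have F1 : F 1 = 1 by apply/kerF/upper_central1.
have FX h m : F (h ^+ m) = F h ^+ m.
  by elim: m => [|m IHm]; rewrite ?expg0 // !expgS FM IHm.
have FV h : F h^-1 = (F h)^-1.
  by apply: (mulgI (F h)); rewrite -FM !mulgV.
have FR g h : F [~ g, h] = [~ F g, F h] by rewrite /commg /conjg !FM !FV.
rewrite -Fy -FX; apply/kerF/(upper_central2_swap odd_n (x := x)).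
(* An element of [H] is a word in [x] and [y] with the same image, times an element of the kernel.
   Words without inverses suffice because [G] is finite. *)
- move=> P Px Py PZ PM h.
  have [w Pw Fw]: exists2 w, P w & F w = F h.
    have: F h \in <<[set a; b]>> by rewrite genG.
    case/gen_prodgP=> m [d d_ab ->].
    elim: m d d_ab => [|m IHm] d d_ab.
      by exists 1; rewrite ?big_ord0 //; apply: PZ; apply: upper_central1.
    have [w Pw Fw] := IHm _ (fun i => d_ab (lift ord0 i)).
    have [/set2P[d0|d0]] := d_ab ord0.
      by exists (x * w); [apply: PM | rewrite big_ord_recl FM Fx Fw d0].
    by exists (y * w); [apply: PM | rewrite big_ord_recl FM Fy Fw d0].
  rewrite -(mulVKg w h); apply: PM => //; apply: PZ; apply/kerF.
  by rewrite FM FV Fw mulVg.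
- move=> w; apply/kerF; rewrite !FR; apply/eqP/commgP.
  have /centerP[_]: [~ F x, F y] \in 'Z(G).
    by rewrite (subsetP G_class2) // mem_commg.
  by apply.
by apply/kerF; rewrite FX Fx.
Qed.

Lemma capable2_order a b : capable 2 G -> odd #|G| -> <<[set a; b]>> = G ->
  #[a] = #[b].
Proof.
move=> capG oddG genG.
have odd_order x : x \in <<[set a; b]>> -> odd #[x].
  by rewrite genG => Gx; apply: dvdn_odd (order_dvdG Gx) oddG.
apply/eqP; rewrite eqn_dvd !order_dvdn; apply/andP; split; apply/eqP.
  apply: (capable2_expg1 capG _ _ (expg_order b)); first by rewrite setUC.
  by apply/odd_order/mem_gen/set22.
by apply: (capable2_expg1 capG genG _ (expg_order a)); apply/odd_order/mem_gen/set21.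
Qed.

End CapableToOrders.

(** * The groups of the list *)

Lemma cycle_joing_gen (gT : finGroupType) (a b : gT) :
  <[a]> <*> <[b]> = <<[set a; b]>>.
Proof. by rewrite /cycle joing_idl joing_idr. Qed.

Lemma card_joing_cycle (gT : finGroupType) (Z : {group gT}) x n :
  x \in 'N(Z) -> x ^+ n \in Z -> #|Z <*> <[x]>| %| #|Z| * n.
Proof.
move=> nZx Zxn.
have nZ: Z <*> <[x]> \subset 'N(Z) by rewrite join_subG normG cycle_subG.
rewrite -(Lagrange (joing_subl Z <[x]>)) dvdn_pmul2l ?cardG_gt0 //.
rewrite -card_quotient // quotientYidl ?cycle_subG // quotient_cycle //.
by rewrite -orderE order_dvdn -morphX //= coset_id.
Qed.

Lemma joing_cycle_expg (gT : finGroupType) (Z : {group gT}) x m n :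
    x \in 'N(Z) -> #|Z <*> <[x]>| = (#|Z| * m)%N -> x ^+ n \in Z -> m %| n.
Proof.
move=> nZx cardZx Zxn.
have nZ: Z <*> <[x]> \subset 'N(Z) by rewrite join_subG normG cycle_subG.
have <- : #[coset Z x] = m.
  apply/eqP; rewrite -(eqn_pmul2l (cardG_gt0 Z)) -cardZx.
  rewrite -(Lagrange (joing_subl Z <[x]>)) -card_quotient //.
  by rewrite quotientYidl ?cycle_subG // quotient_cycle.
by rewrite order_dvdn -morphX //= coset_id.
Qed.

(* The exponents of the three families in a common form, with the relation
   [b ^+ (p ^ beta) = [~ a, b] ^+ (p ^ sigma)]: the first two have
   [sigma = gamma], so that both sides are trivial. *)
Record exponents := Exponents { ealpha : nat; ebeta : nat; egamma : nat; esigma : nat }.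

Definition member_exponents (m : member) : exponents :=
  match m with
  | G1 alpha => Exponents alpha alpha alpha alpha
  | G2 alpha gamma => Exponents alpha alpha gamma gamma
  | G3 alpha beta gamma sigma => Exponents alpha beta gamma sigma
  end.

(** The equation is the additive form of [alpha - beta = gamma - sigma]. Equality [sigma = gamma] is
    now allowed and then forces [alpha = beta]. *)
Definition exponents_ok (e : exponents) : bool :=
  [&& ebeta e <= ealpha e, egamma e <= ebeta e, 0 < egamma e,
      ealpha e + esigma e == ebeta e + egamma e & esigma e <= egamma e].

Lemma admissible_exponents m : admissible m -> exponents_ok (member_exponents m).
Proof.
case: m => [a|a c|a b c s] /=; rewrite /exponents_ok /=.
- by move=> ->; rewrite !leqnn eqxx.
- by case/andP=> /ltnW -> ->; rewrite !leqnn eqxx.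
case/and5P=> leba lecb -> /eqP eq_ab ltsc; rewrite leba lecb (ltnW ltsc) !andbT /=.
by rewrite -(subnKC leba) eq_ab -addnA subnK // ltnW.
Qed.

(** The third family is [sigma < gamma]; when [sigma = gamma], the first two are told apart by
    [gamma = alpha] or [gamma < alpha]. *)
Lemma exponents_member e : exponents_ok e ->
  exists2 m, admissible m & member_exponents m = e.
Proof.
case: e => a b c s; rewrite /exponents_ok /= => /and5P[leba lecb c_gt0 /eqP eq_as].
rewrite leq_eqVlt => /predU1P[eq_sc | ltsc]; last first.
  exists (G3 a b c s) => //=; rewrite leba lecb c_gt0 ltsc andbT /=.
  by rewrite -(eqn_add2r (b + s)) addnA subnK // addnCA eq_as subnK // ltnW.
have eq_ab: a = b by apply: (@addIn s); rewrite eq_as eq_sc.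
rewrite -eq_ab eq_sc in lecb *; move: lecb; rewrite leq_eqVlt => /predU1P[<- | ltca].
  by exists (G1 c).
by exists (G2 a c) => //=; rewrite ltca.
Qed.

Lemma member_exponents_inj : {in admissible &, injective member_exponents}.
Proof.
move=> [a|a c|a b c s] [a'|a' c'|a' b' c' s']; rewrite !unfold_in /=.
- by move=> _ _ [->].
- by move=> _ /andP[ltca _] [eqa _ eqc _]; rewrite -eqa -eqc ltnn in ltca.
- by move=> _ /and5P[_ _ _ _ lt] [_ _ eqc eqs]; rewrite -eqs -eqc ltnn in lt.
- by move=> /andP[ltca _] _ [eqa _ eqc _]; rewrite eqa eqc ltnn in ltca.
- by move=> _ _ [-> _ -> _].
- by move=> _ /and5P[_ _ _ _ lt] [_ _ eqc eqs]; rewrite -eqs -eqc ltnn in lt.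
- by move=> /and5P[_ _ _ _ lt] _ [_ _ eqc eqs]; rewrite eqs eqc ltnn in lt.
- by move=> /and5P[_ _ _ _ lt] _ [_ _ eqc eqs]; rewrite eqs eqc ltnn in lt.
by move=> _ _ [-> -> -> ->].
Qed.

Definition sat_relations p e (gT : finGroupType) (a b : gT) : Prop :=
  [/\ a ^+ (p ^ ealpha e) = 1, b ^+ (p ^ ebeta e) = [~ a, b] ^+ (p ^ esigma e),
      [~ a, b] ^+ (p ^ egamma e) = 1, [~ a, b, a] = 1 & [~ a, b, b] = 1].

(** * Upper bounds on the order from the relations *)

Section Relations.

Variables (p : nat) (e : exponents) (gT : finGroupType) (a b : gT).
Hypothesis rel_ab : sat_relations p e a b.
Let c := [~ a, b].
Let K := <<[set a; b]>>.
Let W := <[c]> <*> <[b]>.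

Lemma relations_comm_center : c \in 'C(K).
Proof.
have [_ _ _ cca ccb] := rel_ab; rewrite cent_gen; apply/centP=> _ /set2P[]->.
  exact/commgP/eqP.
exact/commgP/eqP.
Qed.

Lemma relations_der1 : K^`(1) = <[c]>.
Proof.
have := @der1_joing_cycles _ a b; rewrite cycle_joing_gen /=; apply.
exact: relations_comm_center.
Qed.

Lemma relations_card_c : #|<[c]>| %| p ^ egamma e.
Proof. by have [_ _ c1 _ _] := rel_ab; rewrite -orderE order_dvdn; apply/eqP. Qed.

Lemma relations_card_W : #|W| %| #|<[c]>| * p ^ ebeta e.
Proof.
have [_ bB _ _ ccb] := rel_ab; apply: card_joing_cycle.
  rewrite (subsetP (cent_sub _)) // cent_cycle.
  by apply/cent1P/commgP; rewrite commg1_sym ccb.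
by rewrite bB mem_cycle.
Qed.

Lemma relations_abelian_W : abelian W.
Proof.
have [_ _ _ _ ccb] := rel_ab; rewrite abelianY !cycle_abelian /=.
by rewrite cycle_subG /= cent_cycle; apply/cent1P/commgP; rewrite commg1_sym ccb.
Qed.

Lemma relations_norm_W : K \subset 'N(W).
Proof.
have sWK: W \subset K.
  by rewrite join_subG !cycle_subG groupR ?mem_gen ?set21 ?set22.
by apply: normal_norm; apply: sub_der1_normal => //; rewrite relations_der1 joing_subl.
Qed.

Lemma relations_gen_W : W <*> <[a]> = K.
Proof.
have Ka: a \in K by rewrite mem_gen ?set21.
have Kb: b \in K by rewrite mem_gen ?set22.
apply/eqP; rewrite eqEsubset !join_subG !cycle_subG groupR // Ka Kb /=.
rewrite !sub1set -!cycle_subG joing_subr /=.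
by rewrite (subset_trans _ (joing_subl _ _)) ?joing_subr.
Qed.

Lemma relations_card : #|K| %| #|W| * p ^ ealpha e.
Proof.
have [aA _ _ _ _] := rel_ab; rewrite -relations_gen_W; apply: card_joing_cycle.
  by rewrite (subsetP relations_norm_W) // mem_gen ?set21.
by rewrite aA group1.
Qed.

(** The chain [1], [<[c]>], [W], [K] has factors of orders dividing [p ^ egamma e], [p ^ ebeta e]
    and [p ^ ealpha e]. *)
Lemma relations_card_dvd : #|K| %| p ^ (ealpha e + ebeta e + egamma e).
Proof.
rewrite addnC (addnC (ealpha e)) addnA !expnD.
rewrite (dvdn_trans relations_card) // dvdn_mul //.
by rewrite (dvdn_trans relations_card_W) // dvdn_mul // relations_card_c.
Qed.

End Relations.

Lemma gen_morphim2 (aT rT : finGroupType) (D : {group aT})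
    (f : {morphism D >-> rT}) (a b : aT) :
  a \in D -> b \in D -> f @* <<[set a; b]>> = <<[set f a; f b]>>.
Proof.
move=> Da Db; rewrite morphim_gen ?subUset ?sub1set ?Da //.
by rewrite morphimU !morphim_set1.
Qed.

(* [K] is the subgroup of the product [G * H] generated by the pairs of
   generators; it is no larger than [G], so it is the graph of a morphism. *)
Lemma relations_homg p e (gT rT : finGroupType) (a b : gT) (x y : rT) :
    0 < p -> sat_relations p e a b ->
    #|<<[set a; b]>>| = (p ^ (ealpha e + ebeta e + egamma e))%N ->
  sat_relations p e x y -> <<[set x; y]>> \homg <<[set a; b]>>.
Proof.
move=> p_gt0 rel_ab cardG rel_xy.
have rel_K: sat_relations p e (a, x) (b, y).
  case: rel_ab rel_xy => [aA bB cC cca ccb] [xA yB dC ddx ddy].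
  have pairX (u : gT) (v : rT) n : (u, v) ^+ n = (u ^+ n, v ^+ n).
    by elim: n => [|n IHn] //; rewrite !expgS IHn.
  have pairR (u u' : gT) (v v' : rT) : [~ (u, v), (u', v')] = ([~ u, u'], [~ v, v']).
    by [].
  by split; rewrite ?pairR ?pairX ?aA ?xA ?bB ?yB ?cC ?dC ?cca ?ddx ?ccb ?ddy.
set K := <<[set (a, x); (b, y)]>>.
have fstK: [morphism of fst] @* K = <<[set a; b]>> by rewrite gen_morphim2 ?inE.
have sndK: [morphism of snd] @* K = <<[set x; y]>> by rewrite gen_morphim2 ?inE.
have isoKG: K \isog <<[set a; b]>>.
  rewrite isog_sym isogEcard /= -{1}fstK morphim_homg ?subsetT //= cardG.
  by rewrite dvdn_leq ?expn_gt0 ?p_gt0 ?(relations_card_dvd rel_K).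
by rewrite -sndK; apply: homg_trans (isog_hom isoKG); rewrite morphim_homg ?subsetT.
Qed.

(** Lets the three presentations be handled at once through [sat_relations]. *)
Lemma member_presentation p m : admissible m ->
  exists phi : Presentation.term -> Presentation.type,
    (forall (gT : finGroupType) (G : {group gT}),
       isog_member p G m <-> G \isog Grp phi)
    /\ (forall (rT : finGroupType) (K : {group rT}), (K \homg Grp phi) <->
       exists x y, <<[set x; y]>> = K /\ sat_relations p (member_exponents m) x y).
Proof.
move=> m_ok; case: m m_ok => [a|a c|a b c s] _ /=.
(* Unification reads [phi] off the presentation inside [isog_member]. *)
all: eexists; split=> [gT G|rT K]; first exact: iff_refl.
all: split=> [/existsP[[x y] /= /eqP[<- r1 r2 r3 r4 r5]]|[x [y [<- []]]]].
all: rewrite /= ?cycle_joing_gen.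
all: try by exists x, y; split=> [//|]; split=> //=; rewrite r1 r3.
all: move=> xA yB cC cx cy; apply/existsP; exists (x, y).
all: by rewrite /= cycle_joing_gen yB cC xA cx cy eqxx.
Qed.

(** * The Heisenberg group and a model of full order *)

Section Heisenberg.

Variable q : nat.

(** The triple [(i, j, k)] stands for the upper unitriangular matrix with [i], [j] above the
    diagonal and [k] in the corner. *)
Definition heisenberg : Type := ('Z_q * 'Z_q * 'Z_q)%type.

HB.instance Definition _ := Finite.on heisenberg.

Import GRing.Theory.
Local Open Scope ring_scope.

Definition heis (i j k : 'Z_q) : heisenberg := (i, j, k).
Arguments heis (i j k)%_ring_scope.

Definition heis_mul (u v : heisenberg) : heisenberg :=
  (u.1.1 + v.1.1, u.1.2 + v.1.2, u.2 + v.2 + u.1.1 * v.1.2).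

Definition heis_inv (u : heisenberg) : heisenberg :=
  (- u.1.1, - u.1.2, u.1.1 * u.1.2 - u.2).

Lemma heis_mulA : associative heis_mul.
Proof.
move=> [[i j] k] [[i' j'] k'] [[i'' j''] k'']; rewrite /heis_mul /=.
by rewrite !addrA; congr (_, _, _); ring.
Qed.

Lemma heis_mul1 : left_id (heis 0 0 0) heis_mul.
Proof. by move=> [[i j] k]; rewrite /heis_mul /= !add0r mul0r addr0. Qed.

Lemma heis_mulV : left_inverse (heis 0 0 0) heis_inv heis_mul.
Proof.
by move=> [[i j] k]; rewrite /heis_mul /= !addNr mulNr subrK addrN.
Qed.

HB.instance Definition _ :=
  Finite_isGroup.Build heisenberg heis_mulA heis_mul1 heis_mulV.

Lemma heisM i j k i' j' k' :
  (heis i j k * heis i' j' k')%g = heis (i + i') (j + j') (k + k' + i * j').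
Proof. by []. Qed.

Lemma heis0jkX j k n : (heis 0 j k ^+ n)%g = heis 0 (j *+ n) (k *+ n).
Proof.
elim: n => [|n IHn] //.
by rewrite expgS IHn heisM mul0r !addr0 !mulrS.
Qed.

Lemma heisi00X i n : (heis i 0 0 ^+ n)%g = heis (i *+ n) 0 0.
Proof.
elim: n => [|n IHn] //.
by rewrite expgS IHn heisM mulr0 !addr0 !mulrS.
Qed.

Lemma heis_comm_x j k : [~ heis 1 0 0, heis 0 j k]%g = heis 0 0 j.
Proof.
apply: (mulgI (heis 0 j k * heis 1 0 0)%g); rewrite -commgC !heisM.
by congr heis; ring.
Qed.

Lemma heis_comm_y j k :
  (heis 0 1 0 * heis 0 j k = heis 0 j k * heis 0 1 0)%g.
Proof.
by rewrite !heisM; congr heis; ring.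
Qed.

Lemma heis_center k u : (heis 0 0 k * u = u * heis 0 0 k)%g.
Proof.
by case: u => [[i j] k']; rewrite -/(heis i j k') !heisM; congr heis; ring.
Qed.

Lemma heis_gen : <<[set heis 1 0 0; heis 0 1 0]>>%g = [set: heisenberg].
Proof.
apply/eqP; rewrite eqEsubset subsetT; apply/subsetP=> [[[i j] k]] _.
pose G := <<[set heis 1 0 0; heis 0 1 0]>>%G; change ((i, j, k) \in G).
have Gx: heis 1 0 0 \in G by rewrite mem_gen ?set21.
have Gy: heis 0 1 0 \in G by rewrite mem_gen ?set22.
have Gc: heis 0 0 1 \in G by rewrite -(heis_comm_x 1 0) groupR.
(* With the power of [heis 0 1 0] first, the product has no cross term. *)
have -> : (i, j, k) = (heis 0 1 0 ^+ j * heis 1 0 0 ^+ i * heis 0 0 1 ^+ k)%g.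
  rewrite !heis0jkX heisi00X !heisM !mul0rn !(mulr0, mul0r, add0r, addr0).
  by rewrite !natr_Zp.
exact: groupM (groupM (groupX j Gy) (groupX i Gx)) (groupX k Gc).
Qed.

Lemma card_heisenberg : (1 < q)%N -> #|[set: heisenberg]| = (q ^ 3)%N.
Proof.
move=> q_gt1; rewrite cardsT !card_prod !card_ord Zp_cast //.
by rewrite !expnS expn0 muln1 mulnA.
Qed.

Lemma heis_opp j k : (heis 0 j k)^-1%g = heis 0 (- j) (- k).
Proof. by apply: (mulgI (heis 0 j k)); rewrite mulgV heisM mul0r !addrN !addr0. Qed.

Lemma Zp_nat_eq0 n : (1 < q)%N -> (q %| n)%N -> n%:R = 0 :> 'Z_q.
Proof. by move=> q_gt1 /dvdnP[k ->]; rewrite natrM pchar_Zp // mulr0. Qed.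

End Heisenberg.

(* The model is the Heisenberg group modulo the cyclic normal subgroup generated
   by [y ^+ (p ^ beta) * [~ x, y] ^- (p ^ sigma)]. *)
Lemma relations_model p e : 1 < p -> exponents_ok e ->
  exists (rT : finGroupType) (x y : rT), sat_relations p e x y /\
    p ^ (ealpha e + ebeta e + egamma e) <= #|<<[set x; y]>>|.
Proof.
move=> p_gt1; case: e => A B C S /and5P[/= leBA leCB C_gt0 /eqP eqAS leSC].
set q := (p ^ A)%N; have q_gt1: 1 < q.
  by rewrite -(expn0 p) ltn_exp2l // (leq_trans C_gt0) // (leq_trans leCB).
pose x := heis (q := q) 1%R 0%R 0%R; pose y := heis (q := q) 0%R 1%R 0%R.
pose z := heis (q := q) 0%R (p ^ B)%:R%R (- (p ^ S)%:R)%R.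
have zX n : z ^+ n = heis 0%R (p ^ B * n)%:R%R (- (p ^ S * n)%:R)%R.
  by rewrite heis0jkX GRing.mulNrn -!GRing.mulrnA.
have cX n : [~ x, y] ^+ n = heis 0%R 0%R n%:R%R.
  by rewrite heis_comm_x heis0jkX GRing.mul0rn.
have q0 n : A <= n -> ((p ^ n)%:R = 0 :> 'Z_q)%R.
  by move=> leAn; rewrite Zp_nat_eq0 // dvdn_exp2l.
(* This makes [z ^+ (p ^ (B - S))] equal to [[~ x, y] ^- (p ^ B)], the power of [y] being trivial.
   As [[~ x, z] = [~ x, y] ^+ (p ^ B)], [x] normalizes [<[z]>]. *)
have leAB : A <= B + B - S.
  rewrite leq_subRL ?(leq_trans (leq_trans leSC leCB) (leq_addr _ _)) //.
  by rewrite addnC eqAS leq_add2l.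
have leSB : S <= B := leq_trans leSC leCB.
have z_norm u : u \in [set x; y] -> u \in 'N(<[z]>).
  rewrite -cycle_subG norms_cycle => /set2P[]->.
    rewrite conjg_mulR groupM ?cycle_id // -invgR groupV heis_comm_x -groupV.
    rewrite heis_opp; apply/cycleP; exists (p ^ (B - S))%N.
    by rewrite zX -!expnD !addnBA // addKn (q0 (B + B - S)) // GRing.oppr0.
  have /commgP/conjg_fixP ->: commute z y by apply/commute_sym/heis_comm_y.
  exact: cycle_id.
have nz : [set: heisenberg q] \subset 'N(<[z]>).
  by rewrite -heis_gen gen_subG; apply/subsetP.
have Nz u : u \in 'N(<[z]>) by rewrite (subsetP nz) ?inE.
exists (coset_of <[z]>), (coset <[z]> x), (coset <[z]> y); split.
  have cc0 u : [~ x, y, u] = 1.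
    by rewrite heis_comm_x; apply/eqP/commgP/heis_center.
  split=> /=.
  - by rewrite -morphX // heisi00X q0 // morph1.
  - have yB: y ^+ (p ^ B) = z * [~ x, y] ^+ (p ^ S).
      by rewrite cX heis0jkX heisM GRing.mul0rn GRing.mul0r GRing.addNr !GRing.addr0.
    rewrite -morphX // yB morphM // morphX // morphR //=.
    by rewrite coset_id ?cycle_id // mul1g.
  (* Here [z ^+ (p ^ (C - S))] is [[~ x, y] ^- (p ^ C)], because [B + (C - S) = A] kills the power
     of [y]. *)
  - rewrite -morphR // -morphX //; apply/coset_id; rewrite -groupV cX heis_opp.
    apply/cycleP; exists (p ^ (C - S))%N.
    rewrite zX -!expnD !addnBA // -eqAS addnK addKn (q0 A) //.
    by rewrite GRing.oppr0.
  - by rewrite -!morphR // cc0 morph1.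
  - by rewrite -!morphR // cc0 morph1.
rewrite -gen_morphim2 // heis_gen -/(quotient _ _) card_quotient //.
(* The quotient then has order at least [p ^ (3 * A - (A - S))], and [2 * A + S = A + B + C]. *)
have zA: #[z] <= p ^ (A - S).
  rewrite dvdn_leq ?expn_gt0 ?(ltnW p_gt1) // order_dvdn zX -!expnD; apply/eqP.
  rewrite !q0 ?GRing.oppr0 //.
    by rewrite subnKC // (leq_trans leSB).
  by rewrite -leq_subLR leq_sub.
rewrite -(leq_pmul2l (order_gt0 z)) orderE [X in _ <= X]Lagrange ?subsetT //.
rewrite card_heisenberg // -orderE (leq_trans (leq_mul zA (leqnn _))) //.
rewrite -expnD -expnM leq_exp2l // -addnA -eqAS mulnC !mulSn mul0n addn0.
by rewrite (addnC A S) !addnA [A - S + A + _]addnAC subnK ?(leq_trans leSB) // addnC.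
Qed.

(** * Groups satisfying the relations with full order *)

Section ExactRelations.

Variables (p : nat) (e : exponents) (gT : finGroupType) (a b : gT).
Hypothesis p_gt1 : 1 < p.
Hypothesis rel_ab : sat_relations p e a b.
Let c := [~ a, b].
Let K := <<[set a; b]>>.
Let W := <[c]> <*> <[b]>.
Hypothesis cardK : #|K| = (p ^ (ealpha e + ebeta e + egamma e))%N.

Let p_gt0 n : 0 < p ^ n. Proof. by rewrite expn_gt0 ltnW. Qed.

(** Equality for the whole group forces equality at each step of the chain of bounds. *)
Lemma exact_relations_card :
  #|<[c]>| = (p ^ egamma e)%N /\ #|W| = (p ^ egamma e * p ^ ebeta e)%N.
Proof.
have c_le : #|<[c]>| <= p ^ egamma e := dvdn_leq (p_gt0 _) (relations_card_c rel_ab).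
have W_le : #|W| <= #|<[c]>| * p ^ ebeta e.
  by rewrite dvdn_leq ?relations_card_W // muln_gt0 cardG_gt0 p_gt0.
have K_le : p ^ egamma e * p ^ ebeta e <= #|W|.
  rewrite -(leq_pmul2r (p_gt0 (ealpha e))) -!expnD addnC [(_ + ebeta e)%N]addnC addnA.
  by rewrite -cardK dvdn_leq ?relations_card // muln_gt0 cardG_gt0 p_gt0.
have c_ge := leq_trans K_le W_le; rewrite leq_pmul2r // in c_ge.
have cardc: #|<[c]>| = (p ^ egamma e)%N by apply/eqP; rewrite eqn_leq c_le.
by split=> //; apply/eqP; rewrite eqn_leq K_le -{1}cardc W_le.
Qed.

Lemma exact_relations_expg n : a ^+ n \in W -> p ^ ealpha e %| n.
Proof.
have [cardc cardW] := exact_relations_card.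
have Ka: a \in K by rewrite mem_gen ?set21.
apply: joing_cycle_expg; first exact: subsetP (relations_norm_W rel_ab) a Ka.
rewrite (relations_gen_W a b) cardK [#|_|]cardW -!expnD.
by rewrite -addnA addnC (addnC (ebeta e)).
Qed.

Lemma exact_relations_expg_b n : b ^+ n \in <[c]> -> p ^ ebeta e %| n.
Proof.
have [cardc cardW] := exact_relations_card.
apply: joing_cycle_expg; last by rewrite [LHS]cardW cardc.
rewrite (subsetP (cent_sub _)) // cent_cycle; apply/cent1P/commgP.
by rewrite commg1_sym; have [_ _ _ _ ->] := rel_ab.
Qed.

(** Modulo the derived subgroup the relations kill the powers [p ^ ealpha e] of both generators, and
    [a] already needs that power to fall into [W]. *)
Lemma exact_relations_exponent :
  ebeta e <= ealpha e -> exponent (K / K^`(1)) = (p ^ ealpha e)%N.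
Proof.
move=> leBA; have [aA bB _ _ _] := rel_ab.
have Ka: a \in K by rewrite mem_gen ?set21.
have Kb: b \in K by rewrite mem_gen ?set22.
have nK u : u \in K -> u \in 'N(K^`(1)) by apply/subsetP/der_norm.
apply/eqP; rewrite eqn_dvd; apply/andP; split.
  have defKK : K / K^`(1) = <<[set coset K^`(1) a; coset K^`(1) b]>>.
    by rewrite /quotient gen_morphim2 ?nK.
  have cKK: abelian (K / K^`(1)) := der_abelian 0 <<[set a; b]>>.
  rewrite defKK.
  rewrite abelian_exponent_gen; last first.
    by apply: abelianS cKK; rewrite defKK subset_gen.
  apply/exponentP=> _ /set2P[]->; rewrite -morphX ?nK //=.
    by rewrite aA morph1.
  rewrite -(subnKC leBA) expnD expgnA bB coset_id // groupX //.
  by rewrite groupX // mem_commg.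
apply: exact_relations_expg; apply: (subsetP (joing_subl _ _)).
rewrite -(relations_der1 rel_ab); apply: coset_idr; first by rewrite groupX ?nK.
by rewrite morphX ?nK //= expg_exponent // mem_quotient.
Qed.

End ExactRelations.

(** The relations bound the order of the presented group above, and the Heisenberg model, one of its
    images, bounds it below. Conversely [relations_homg] gives the universal property. *)
Lemma isog_memberP p (gT : finGroupType) (G : {group gT}) m :
    1 < p -> admissible m ->
  isog_member p G m <-> exists a b, [/\ <<[set a; b]>> = G,
    sat_relations p (member_exponents m) a b
    & #|G| = (p ^ (ealpha (member_exponents m) + ebeta (member_exponents m)
                     + egamma (member_exponents m)))%N].
Proof.
move=> p_gt1 m_ok; have [phi [iso_phi hom_phi]] := member_presentation p m_ok.
set e := member_exponents m in hom_phi *; split=> [/iso_phi isoG|].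
  have /hom_phi[a [b [genG rel_ab]]] := isoGrp_hom isoG.
  exists a, b; split=> //; apply/eqP; rewrite eqn_leq -genG.
  rewrite dvdn_leq ?expn_gt0 ?(ltnW p_gt1) ?(relations_card_dvd rel_ab) //=.
  have [rT [x [y [rel_xy le_card]]]] := relations_model p_gt1 (admissible_exponents m_ok).
  have /hom_phi : exists x' y',
      <<[set x'; y']>> = <<[set x; y]>>%G /\ sat_relations p e x' y'.
    by exists x, y.
  by rewrite -isoG => /leq_homg le_G; rewrite genG (leq_trans le_card le_G).
case=> a [b [genG rel_ab cardG]]; apply/iso_phi/intro_isoGrp.
  by apply/hom_phi; exists a, b.
move=> rT K /hom_phi[x [y [<- rel_xy]]]; rewrite -genG.
by apply: (relations_homg _ rel_ab); rewrite ?(ltnW p_gt1) // genG.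
Qed.

(** The exponent of the abelianization gives [alpha], the order of the derived subgroup [gamma], the
    order of [G] then [beta], and the linear equation [sigma]. *)
Lemma isog_member_inj p (gT : finGroupType) (G : {group gT}) m n :
    1 < p -> admissible m -> admissible n ->
  isog_member p G m -> isog_member p G n -> m = n.
Proof.
move=> p_gt1 m_ok n_ok /isog_memberP-/(_ p_gt1 m_ok)[a [b [genG rel_ab oG]]].
move=> /isog_memberP-/(_ p_gt1 n_ok)[x [y [genG' rel_xy oG']]].
apply: member_exponents_inj => //.
have /and5P[em1 em2 em3 /eqP em4 _] := admissible_exponents m_ok.
have /and5P[en1 en2 en3 /eqP en4 _] := admissible_exponents n_ok.
have expI i j : (p ^ i)%N = (p ^ j)%N -> i = j by move/eqP; rewrite eqn_exp2l // => /eqP.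
have eqA: ealpha (member_exponents m) = ealpha (member_exponents n).
  apply: expI; rewrite -(exact_relations_exponent p_gt1 rel_ab) ?genG //.
  by rewrite -(exact_relations_exponent p_gt1 rel_xy) ?genG'.
have eqC: egamma (member_exponents m) = egamma (member_exponents n).
  apply: expI; rewrite -genG in oG; rewrite -genG' in oG'.
  have [<- _] := exact_relations_card p_gt1 rel_ab oG.
  have [<- _] := exact_relations_card p_gt1 rel_xy oG'.
  by rewrite -(relations_der1 rel_ab) -(relations_der1 rel_xy) genG genG'.
have eqB: ebeta (member_exponents m) = ebeta (member_exponents n).
  have /expI/eqP := etrans (esym oG) oG'.
  by rewrite eqA eqC eqn_add2r eqn_add2l => /eqP.
have eqS: esigma (member_exponents m) = esigma (member_exponents n).
  by apply: (@addnI (ealpha (member_exponents m))); rewrite em4 eqA en4 eqB eqC.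
move: eqA eqB eqC eqS; case: (member_exponents m) => ? ? ? ?.
by case: (member_exponents n) => ? ? ? ? /= -> -> -> ->.
Qed.

(** * From equal orders to the relations *)

(** The rank is at most two, and noncyclicity excludes fewer than two factors. *)
Lemma abelian_two_generated (gT : finGroupType) (A : {group gT}) (u v : gT) :
    abelian A -> <<[set u; v]>> = A -> ~~ cyclic A ->
  exists x y, <[x]> \x <[y]> = A /\ #[y] <= #[x].
Proof.
move=> cAA genA ncA; have [b defA ob] := abelian_structure cAA.
have: size b <= 2.
  rewrite -(size_map order) ob size_abelian_type // -grank_abelian // -genA.
  by rewrite (leq_trans (grank_min _)) // cards2; case: (_ != _).
have := abelian_type_sorted A; rewrite -ob.
case: b defA {ob} => [|x [|y [|]]] //; rewrite ?(big_cons, big_nil, dprodg1).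
- by move=> A1; rewrite -A1 cyclic1 in ncA.
- by move=> defA; rewrite -defA cycle_cyclic in ncA.
by move=> defA /= /andP[le_yx _] _; exists x, y; rewrite -[in RHS]defA.
Qed.

(** Burnside's basis argument: the derived subgroup lies in the Frattini subgroup, whose elements
    are nongenerators. *)
Lemma gen_quotient_der1 (p : nat) (gT : finGroupType) (G X : {group gT}) :
  p.-group G -> X \subset G -> G / G^`(1) \subset X / G^`(1) -> X :=: G.
Proof.
move=> pG sXG sGX; apply/eqP; rewrite -[X in X == _]genGid; apply/eqP.
apply: Phi_nongen; apply/eqP; rewrite eqEsubset join_subG Phi_sub sXG /=.
have sGphi: G^`(1) \subset 'Phi(G) by rewrite (Phi_joing pG) joing_subl.
apply: subset_trans (genS (setSU X sGphi)).
rewrite -(quotientSGK (der_norm 1 G)) ?joing_subl // quotientYidl //.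
by rewrite (subset_trans sXG) ?der_norm.
Qed.

(** The abelianization is not cyclic, since a cyclic quotient by a central subgroup would make [G]
    abelian; lifts of its basis generate [G]. *)
Lemma class2_two_generated (p : nat) (gT : finGroupType) (G : {group gT}) :
    p.-group G -> two_generated G -> G^`(1) \subset 'Z(G) -> ~~ abelian G ->
  exists x y, [/\ <<[set x; y]>> = G,
    <[coset G^`(1) x]> \x <[coset G^`(1) y]> = G / G^`(1)
    & #[coset G^`(1) y] <= #[coset G^`(1) x]].
Proof.
move=> pG [u [v genG]] sGZ ncG; have nG := der_norm 1 G.
have Gu: u \in G by rewrite -genG mem_gen ?set21.
have Gv: v \in G by rewrite -genG mem_gen ?set22.
have [|||xb [yb [defA le_xy]]] :=
    @abelian_two_generated _ (G / G^`(1))%G (coset G^`(1) u) (coset G^`(1) v).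
- exact: der_abelian 0 G.
- by rewrite -gen_morphim2 ?(subsetP nG) ?genG.
- by apply: contra ncG => /(cyclic_factor_abelian sGZ).
have defM: <[xb]> * <[yb]> = G / G^`(1) by case/dprodP: defA.
have /morphimP[x Nx Gx Dx]: xb \in G / G^`(1).
  by rewrite -defM (subsetP (mulG_subl _ _)) ?cycle_id.
have /morphimP[y Ny Gy Dy]: yb \in G / G^`(1).
  by rewrite -defM (subsetP (mulG_subr _ _)) ?cycle_id.
rewrite {}Dx {}Dy /= in defA defM le_xy.
exists x, y; split=> //; apply: (gen_quotient_der1 pG).
  by rewrite gen_subG subUset !sub1set Gx.
rewrite -defM mul_subG // cycle_subG mem_quotient ?mem_gen ?set21 ?set22 //.
Qed.

Lemma gen_set2_eq (gT : finGroupType) (x y u v : gT) :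
    u \in <<[set x; y]>> -> v \in <<[set x; y]>> ->
    x \in <<[set u; v]>> -> y \in <<[set u; v]>> ->
  <<[set u; v]>> = <<[set x; y]>>.
Proof.
move=> Gu Gv Gx Gy; apply/eqP.
by rewrite eqEsubset !gen_subG !subUset !sub1set Gu Gv Gx Gy.
Qed.

(** Subgroups of [<[c]>] are determined by their orders, so [d] generates [<[c ^+ (p ^ (n - k))]>],
    and its exponent there is coprime to [p ^ k]. For [k = 0] this says nothing about [p], whence
    the separate choice 1. *)
Lemma cyclic_pfactor_generator p n k (gT : finGroupType) (c d : gT) :
    prime p -> #[c] = (p ^ n)%N -> d \in <[c]> -> #[d] = (p ^ k)%N ->
  k <= n /\ exists2 w, coprime (p ^ n) w & (c ^+ w) ^+ (p ^ (n - k)) = d.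
Proof.
move=> p_pr oc cd od; have p_gt1 := prime_gt1 p_pr.
have le_kn: k <= n.
  by rewrite -(leq_exp2l _ _ p_gt1) -oc -od dvdn_leq ?order_gt0 ?order_dvdG.
split=> //; have [k0|k_gt0] := posnP k.
  exists 1%N; first exact: coprimen1.
  rewrite k0 expn0 in od; rewrite k0 subn0 expg1 -oc expg_order.
  by apply/esym/eqP; rewrite -order_eq1 od.
have ocp: #[c ^+ (p ^ (n - k))] = (p ^ k)%N.
  rewrite orderXdiv oc ?dvdn_exp2l ?leq_subr // -expnB ?leq_subr ?subKn //.
  exact: ltnW.
have /eqP def_d: <[d]> == <[c ^+ (p ^ (n - k))]>.
  by rewrite (eq_subG_cyclic (cycle_cyclic c)) ?cycle_subG ?mem_cycle // -!orderE od ocp.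
have /cycleP[w dw]: d \in <[c ^+ (p ^ (n - k))]> by rewrite -def_d cycle_id.
exists w; last by rewrite expgnAC.
have : generator <[c ^+ (p ^ (n - k))]> d by rewrite /generator def_d.
by rewrite dw generator_coprime ocp !coprime_pexpl // (leq_trans k_gt0).
Qed.

(** * Adjusting the generators to the relations *)

Section EqualOrders.

Variables (p : nat) (gT : finGroupType) (G : {group gT}).
Hypotheses (p_pr : prime p) (p_odd : odd p) (pG : p.-group G).
Hypotheses (sGZ : G^`(1) \subset 'Z(G)) (ncG : ~~ abelian G).
Hypothesis eq_orders : forall x y, <<[set x; y]>> = G -> #[x] = #[y].

Lemma class2_commutator x y : x \in G -> y \in G ->
  forall g, g \in G -> commute [~ x, y] g.
Proof.
move=> Gx Gy g Gg; have /centerP[_ cxy]: [~ x, y] \in 'Z(G).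
  by rewrite (subsetP sGZ) ?mem_commg.
exact: cxy.
Qed.

Lemma class2_expMn x y n : x \in G -> y \in G -> odd n -> #[[~ x, y]] %| n ->
  (x * y) ^+ n = x ^+ n * y ^+ n.
Proof.
move=> Gx Gy odd_n o_n; have cxy := class2_commutator Gy Gx.
have cyx: [~ y, x] ^+ 'C(n, 2) = 1.
  apply/eqP; rewrite -order_dvdn -invgR orderV.
  exact: dvdn_trans o_n (dvdn_bin2 odd_n (dvdnn n)).
by rewrite expMg_Rmul ?cyx ?mulg1 //; apply/commute_sym/cxy.
Qed.

Lemma equal_orders_relations : two_generated G -> exists (e : exponents) (a b : gT),
  [/\ exponents_ok e, <<[set a; b]>> = G, sat_relations p e a b
    & #|G| = (p ^ (ealpha e + ebeta e + egamma e))%N].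
Proof.
move=> G_2gen; have p_gt1 := prime_gt1 p_pr.
have [x [y [genG defGG le_yx]]] := class2_two_generated pG G_2gen sGZ ncG.
have nG := subsetP (der_norm 1 G).
have Gx: x \in G by rewrite -genG mem_gen ?set21.
have Gy: y \in G by rewrite -genG mem_gen ?set22.
have Nx := nG _ Gx; have Ny := nG _ Gy.
set c := [~ x, y]; have cc := class2_commutator Gx Gy.
have defG1: G^`(1) = <[c]>.
  rewrite -genG -cycle_joing_gen der1_joing_cycles // cycle_joing_gen genG.
  by apply/centP=> g Gg; apply: cc.
have pow u : p.-elt u -> exists n, #[u] = (p ^ n)%N.
  by move/p_natP=> [n ?]; exists n.
have pGG := quotient_pgroup G^`(1) pG.
have [A oA] := pow _ _ (mem_p_elt pGG (mem_quotient G^`(1) Gx)).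
have [B oB] := pow _ _ (mem_p_elt pGG (mem_quotient G^`(1) Gy)).
have [C oc] := pow _ _ (mem_p_elt pG (groupR Gx Gy)).
rewrite -/c in oc.
have leBA: B <= A by rewrite -(leq_exp2l _ _ p_gt1) -oA -oB.
have in_der u n : u \in 'N(G^`(1)) -> #[coset G^`(1) u] %| n -> u ^+ n \in G^`(1).
  by move=> Nu; rewrite order_dvdn -morphX // => /eqP; apply: coset_idr; rewrite groupX.
have yB: y ^+ (p ^ B) \in <[c]> by rewrite -defG1 in_der ?oB.
have cX n : [~ x, y ^+ n] = c ^+ n.
  by rewrite commgX //; apply/commute_sym/cc.
(* Since [y ^+ (p ^ B)] is a power of the central [c], [c ^+ (p ^ B) = [~ x, y ^+ (p ^ B)] = 1]. *)
have leCB: C <= B.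
  rewrite -(leq_exp2l _ _ p_gt1) -oc dvdn_leq ?expn_gt0 ?(ltnW p_gt1) // order_dvdn.
  rewrite -cX; apply/commgP/commute_sym.
  have /cycleP[i ->] := yB; exact/commute_sym/commuteX/commute_sym/cc.
have C_gt0: 0 < C.
  rewrite lt0n; apply: contra ncG => /eqP C0; apply/derG1P.
  by apply/eqP; rewrite defG1 cycle_eq1 -order_eq1 oc C0.
have oddA: odd (p ^ A) by rewrite oddX p_odd orbT.
have cA : #[c] %| p ^ A by rewrite oc dvdn_exp2l // (leq_trans leCB).
have cardG: #|G| = (p ^ (A + B + C))%N.
  have oG1: #|G^`(1)| = (p ^ C)%N by rewrite defG1.
  have oGG: #|G / G^`(1)| = (p ^ A * p ^ B)%N.
    by rewrite -(dprod_card defGG) -!orderE oA oB.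
  rewrite -(Lagrange (der_sub 1 G)) -card_quotient ?der_norm //= oGG oG1.
  by rewrite -!expnD addnC.
(* [x ^+ (p ^ A)] and [y ^+ (p ^ A)] lie in the cyclic group [<[c]>] and have
   the same order since [x] and [y] do. *)
have xA: x ^+ (p ^ A) \in <[c]> by rewrite -defG1 in_der ?oA.
have yA: y ^+ (p ^ A) \in <[c]>.
  by rewrite -(subnKC leBA) expnD expgnA groupX.
have eq_xy: <[x ^+ (p ^ A)]> = <[y ^+ (p ^ A)]>.
  apply/eqP; rewrite (eq_subG_cyclic (cycle_cyclic c)) ?cycle_subG //.
  by rewrite -!orderE !orderXgcd (eq_orders genG).
have /cycleP[m def_xA]: x ^+ (p ^ A) \in <[y ^+ (p ^ A)]> by rewrite -eq_xy cycle_id.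
(* Chosen so that [v] and [x] have the same power [p ^ A]; then [a = x * v^-1] satisfies
   [a ^+ (p ^ A) = 1] without changing the commutator with [y]. *)
pose v := y ^+ m; have Gv: v \in G by rewrite groupX.
pose a := x * v^-1; have Ga: a \in G by rewrite groupM ?groupV.
have comm_v : [~ x, v^-1] \in <[c]> by rewrite -defG1 mem_commg ?groupV.
have aA: a ^+ (p ^ A) = 1.
  rewrite class2_expMn ?groupV // ?(dvdn_trans (order_dvdG comm_v)) //.
  by rewrite def_xA expVgn -expgnA mulnC expgnA mulgV.
have genG': <<[set a; y]>> = G.
  rewrite -genG; apply: gen_set2_eq; rewrite ?genG //; last by rewrite mem_gen ?set22.
  by rewrite -(mulgVK v x) groupM // ?[v \in _]groupX // mem_gen ?set21 ?set22.
have ay: [~ a, y] = c.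
  rewrite commMgJ (_ : [~ v^-1, y] = 1) ?mulg1; last first.
    by apply/eqP/commgP/commute_sym/commuteV/commuteX.
  by apply/conjg_fixP/commgP/cc; rewrite groupV.
(* If [a ^+ n = 1], then [x ^+ n = v ^+ n] modulo the derived subgroup, where [x] and [y] generate
   cyclic groups with trivial intersection. *)
have oa: #[a] = (p ^ A)%N.
  apply/eqP; rewrite eqn_dvd order_dvdn aA eqxx /= -oA order_dvdn.
  have [_ _ cyx tixy] := dprodP defGG.
  have cxv: commute (coset G^`(1) x) (coset G^`(1) v^-1).
    rewrite morphV ?groupX // morphX //; apply/commuteV/commuteX/commute_sym.
    by apply: (centsP cyx); apply: cycle_id.
  have := congr1 (coset G^`(1)) (expg_order a); rewrite morph1.
  rewrite morphX ?nG // morphM ?nG ?groupV // expgMn //.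
  rewrite morphV ?nG // expVgn => /divg1_eq eq_n.
  rewrite -in_set1 -set1gE -tixy inE mem_cycle /= eq_n.
  by rewrite morphX // groupX ?mem_cycle.
(* Equality of orders is used a second time, for the new pair [a], [y]; it determines the order of
   [y ^+ (p ^ B)] inside [<[c]>]. *)
have oy: #[y] = (p ^ A)%N by rewrite -oa -(eq_orders genG').
have od: #[y ^+ (p ^ B)] = (p ^ (A - B))%N.
  by rewrite orderXdiv oy ?dvdn_exp2l // expnB ?(ltnW p_gt1).
have [leABC [w cow dw]] := cyclic_pfactor_generator p_pr oc yB od.
have co_aw: coprime #[a] w.
  by move: cow; rewrite oa !coprime_pexpl // (leq_trans C_gt0) // (leq_trans leCB).
(* Replacing [a] by [a ^+ w] turns [c] into [c ^+ w], whose power [p ^ (C - (A - B))] is exactly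
   [y ^+ (p ^ B)]. *)
exists (Exponents A B C (C - (A - B))), (a ^+ w), y; split=> //=.
- rewrite /exponents_ok /= leBA leCB C_gt0 leq_subr andbT /=.
  by rewrite -{1}(subnKC leBA) -addnA subnKC.
- rewrite -genG'; apply: gen_set2_eq;
    rewrite ?groupX ?(mem_gen (set22 _ _)) ?(mem_gen (set21 _ _)) //.
  have: <[a]> == <[a ^+ w]> by rewrite -[_ == _]/(generator _ _) generator_coprime.
  move/eqP=> eq_a; have: a \in <[a ^+ w]> by rewrite -eq_a cycle_id.
  by apply/subsetP; rewrite cycle_subG mem_gen ?set21.
have aw: [~ a ^+ w, y] = c ^+ w.
  by rewrite commXg ay //; apply/commute_sym/cc.
split; rewrite /= ?aw //.
- by rewrite expgnAC aA expg1n.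
- by rewrite expgnAC -oc expg_order expg1n.
- by apply/eqP/commgP/commute_sym/commuteX/commute_sym/cc; rewrite groupX.
- by apply/eqP/commgP/commute_sym/commuteX/commute_sym/cc.
Qed.

End EqualOrders.

(** * The 2-capability of the groups of the list *)

(** It suffices to have a finite [H] mapping onto [G] with kernel its second centre: [f] is constant
    on the classes of [uc_quot], so it can be evaluated on representatives. *)
Lemma capable2_morph (hT gT : finGroupType) (H : {group hT}) (G : {group gT})
    (f : hT -> gT) :
    {in H &, {morph f : x y / x * y}} -> {in H, forall h, f h \in G} ->
    {in G, forall g, exists2 h, h \in H & f h = g} ->
    {in H, forall h, f h = 1 <-> {in H &, forall g g', [~ h, g, g'] = 1}} ->
  capable 2 G.
Proof.
move=> fM fG f_onto kerf; pose HT : groupType := subg_of H.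
have Z2E (u : HT) : upper_central 2 u <-> f (sgval u) = 1.
  rewrite kerf ?subgP //; split=> Zu g g'.
    move=> Hg Hg'; have := congr1 sgval (Zu (subg H g) (subg H g')).
    by rewrite /= !subgK.
  by apply: val_inj; apply: (Zu _ _ (subgP g) (subgP g')).
pose F (u : HT) := subg G (f (sgval u)).
have FM u v : F (u * v) = F u * F v.
  apply: val_inj; rewrite /= !subgK ?groupM ?fG ?subgP //.
  by apply: fM; apply: subgP.
have F1 : F 1 = 1 by apply: (mulgI (F 1)); rewrite -FM !mulg1.
have FV u : F u^-1 = (F u)^-1 by apply: (mulgI (F u)); rewrite -FM !mulgV.
have kerF u : F u = 1 <-> upper_central 2 u.
  rewrite Z2E; split=> [/(congr1 sgval)|fu]; first by rewrite /= subgK ?fG ?subgP.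
  by rewrite /F fu; apply: val_inj; rewrite /= subgK.
have F_pi (u v : HT) : uc_pi 2 u = uc_pi 2 v <-> F u = F v.
  rewrite uc_piP -kerF FM FV; split=> [E|->]; last exact: mulVg.
  by apply: (mulgI (F u)^-1); rewrite E mulVg.
pose phi (A : uc_quot HT 2) := F (generic_quotient.repr A).
have phi_pi u : phi (uc_pi 2 u) = F u by apply/F_pi; rewrite uc_reprK.
have phiM : {morph phi : A B / A * B}.
  by move=> A B; rewrite -(uc_reprK A) -(uc_reprK B) [_ * _]uc_piM !phi_pi FM.
pose mul_phi := isMultiplicative.Build (uc_quot HT 2) (subg_of G) phi phiM.
pose phi' : {multiplicative uc_quot HT 2 -> [subg G]} := HB.pack phi mul_phi.
have lift_ex (g : subg_of G) : exists u : HT, F u == g.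
  have [h Hh fh] := f_onto _ (subgP g); exists (subg H h).
  by rewrite /F subgK // fh sgvalK.
exists HT, phi'; exists (fun g => uc_pi 2 (xchoose (lift_ex g))) => [A|g] /=.
  by rewrite -[RHS]uc_reprK; apply/F_pi/eqP/(xchooseP (lift_ex _)).
by rewrite [phi _]phi_pi; apply/eqP/(xchooseP (lift_ex g)).
Qed.

(** * A finite group whose quotient by its second centre is [G] *)

Section Construction.

Variables (gT : finGroupType) (W : {group gT}) (a b : gT).
Hypotheses (cWW : abelian W) (nWa : a \in 'N(W)) (Wb : b \in W).

Let V := subg_of W.
Let V3 := (V * V * V)%type.
Implicit Types (k w : V) (u v : V3).

Lemma subg_mulC k w : k * w = w * k.
Proof. by apply: val_inj; apply: (centsP cWW); apply: subgP. Qed.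

Definition conj_a (w : V) : V := subg W (sgval w ^ a).

Lemma sgval_conj_a w : sgval (conj_a w) = sgval w ^ a.
Proof. by rewrite subgK // memJ_norm ?subgP. Qed.

Definition shift (u : V3) : V3 := (u.1.1, u.1.2 * u.1.1, u.1.2 * conj_a u.2).

Lemma subg_mulACA (k l k' l' : V) : k * k' * (l * l') = k * l * (k' * l').
Proof. by rewrite -!mulgA; congr (_ * _); rewrite !mulgA (subg_mulC k'). Qed.

Lemma conj_aM : {morph conj_a : k w / k * w}.
Proof. by move=> k w; apply: val_inj; rewrite /= !sgval_conj_a conjMg. Qed.

Lemma shiftM : {morph shift : u v / u * v}.
Proof.
move=> [[j k] w] [[j' k'] w']; rewrite /shift /= conj_aM; congr (_, _, _).
  exact: subg_mulACA.
exact: subg_mulACA.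
Qed.

Lemma shift_inj : injective shift.
Proof.
move=> [[j k] w] [[j' k'] w']; rewrite /shift /=.
case=> <- /mulIg/val_inj <- /mulgI; rewrite !sgval_conj_a.
by move=> /conjg_inj/val_inj <-.
Qed.

Lemma V3_mulC u v : u * v = v * u.
Proof.
by case: u v => [[j k] w] [[j' k'] w']; congr (_, _, _); apply: subg_mulC.
Qed.

(* [N (N u)] for [N = shift - 1], as an element of the third factor [W]. *)
Definition N2 (u : V3) : gT := sgval u.1.1 * [~ sgval u.1.2, a].

Let hT := ({perm V3} * gT)%type.

(** The group above [G] is realised by translations and [shift] as permutations of [W ^ 3]; a second
    coordinate in [gT] carries the image, so that the morphism is just [snd]. *)
Definition trans_elt (u : V3) : hT := (perm (mulIg u), N2 u).
Definition shift_elt : hT := (perm shift_inj, a).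


Hypothesis cWa : forall g h, g \in W -> h \in W ->
  commute [~ g, a] h /\ commute [~ g, a] a.

Lemma N2M u v : N2 (u * v) = N2 u * N2 v.
Proof.
case: u v => [[j k] w] [[j' k'] w']; rewrite /N2 /=.
have [ck _] := cWa (subgP k) (subgP k').
rewrite commMgJ (conjg_commute ck).
have [ckj _] := cWa (subgP k) (subgP j').
move: [~ _, a] [~ _, a] ckj => d d' cdj.
by rewrite !mulgA -(mulgA (sgval j) d) cdj !mulgA.
Qed.

Lemma N2_shift u : N2 (shift u) = N2 u ^ a.
Proof.
case: u => [[j k] w]; rewrite /N2 /=.
have [ck cka] := cWa (subgP k) (subgP j).
rewrite commMgJ (conjg_commute ck) conjMg (conjg_commute cka).
have Wja: [~ sgval j, a] \in W by rewrite commgEl groupM ?groupV ?memJ_norm ?subgP.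
have [cdd _] := cWa (subgP k) Wja; rewrite conjg_mulR.
by move: [~ _, a] [~ _, a] cdd => d d' cdd; rewrite -mulgA cdd.
Qed.

Lemma trans_eltM : {morph trans_elt : u v / u * v}.
Proof.
move=> u v; rewrite /trans_elt N2M; congr (_, _).
by apply/permP=> z; rewrite permM !permE mulgA.
Qed.

Lemma trans_elt_inj : injective trans_elt.
Proof.
move=> u v [E _]; have := congr1 (fun s : {perm V3} => s 1) E.
by rewrite !permE !mul1g.
Qed.

Lemma trans_elt_shift u : trans_elt u ^ shift_elt = trans_elt (shift u).
Proof.
rewrite conjgE; apply: (canLR (mulKg _)).
rewrite /trans_elt /shift_elt N2_shift; congr (_, _); last exact: conjgC.
by apply/permP=> z; rewrite !permM !permE shiftM.
Qed.

Lemma trans_elt_iter u i : trans_elt u ^ (shift_elt ^+ i) = trans_elt (iter i shift u).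
Proof.
elim: i => [|i IHi]; first by rewrite conjg1.
by rewrite expgSr conjgM IHi trans_elt_shift.
Qed.

Canonical trans_morphism := @Morphism _ _ [set: V3] trans_elt (in2W trans_eltM).

Let M := trans_elt @* [set: V3].
Let H := <[shift_elt]> <*> M.

Lemma trans_elt_M u : trans_elt u \in M. Proof. by rewrite mem_morphim ?inE. Qed.

Lemma memHP h : h \in H -> exists i u, h = shift_elt ^+ i * trans_elt u.
Proof.
rewrite /H norm_joinEl; last first.
  rewrite cycle_subG inE; apply/subsetP=> _ /imsetP[_ /morphimP[u _ _ ->] ->].
  by rewrite trans_elt_shift trans_elt_M.
by case/mulsgP=> _ _ /cycleP[i ->] /morphimP[u _ _ ->] ->; exists i, u.
Qed.

Lemma trans_comm u v : commute (trans_elt u) (trans_elt v).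
Proof. by rewrite /commute -!trans_eltM V3_mulC. Qed.

Lemma trans_central u h : shift u = u -> h \in H -> commute (trans_elt u) h.
Proof.
move=> fix_u /memHP[i [v ->]]; apply: commuteM; last exact: trans_comm.
by apply/commuteX/commgP/conjg_fixP; rewrite trans_elt_shift fix_u.
Qed.

Lemma commute_shift u : commute (trans_elt u) shift_elt -> shift u = u.
Proof. by move/commgP/conjg_fixP; rewrite trans_elt_shift => /trans_elt_inj. Qed.

Lemma iter_shiftM i : {morph iter i shift : u v / u * v}.
Proof. by elim: i => [|i IHi] u v //=; rewrite IHi shiftM. Qed.

Definition diff i (u : V3) : V3 := u^-1 * iter i shift u.

Lemma trans_eltV u : trans_elt u^-1 = (trans_elt u)^-1.
Proof. exact: (morphV trans_morphism (in_setT u)). Qed.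

Lemma comm_trans_iter i u : [~ trans_elt u, shift_elt ^+ i] = trans_elt (diff i u).
Proof. by rewrite commgEl trans_elt_iter trans_eltM trans_eltV. Qed.

Lemma iter_shiftV i u : iter i shift u^-1 = (iter i shift u)^-1.
Proof.
apply: (mulgI (iter i shift u)); rewrite -iter_shiftM !mulgV.
by apply: (mulgI (iter i shift 1)); rewrite -iter_shiftM !mulg1.
Qed.

(** Additively, with [T = shift], this is the commutation of [T - 1] with [T ^+ i - 1]. *)
Lemma shift_diff i u : shift (diff i u) = diff i u <->
  iter i shift (diff 1 u) = diff 1 u.
Proof.
rewrite /diff /= shiftM iter_shiftM iter_shiftV.
rewrite (iter_shiftV 1 u : shift u^-1 = _) /= -iterSr iterS.
move: (shift u) (iter i shift u) (shift (iter i shift u)) => v w z.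
have key (s t : V3) : s^-1 * z = u^-1 * t <-> u * z = s * t.
  split=> E.
    by rewrite -[z](mulKVg s) E V3_mulC -mulgA (V3_mulC _ u) mulKVg.
  apply: (mulgI s); rewrite mulKVg; apply: (mulgI u).
  by rewrite E !mulgA (V3_mulC u s) -!mulgA mulKVg.
by rewrite !key V3_mulC [v * w]V3_mulC (V3_mulC z).
Qed.

Lemma expg_mulV_S (j w : V) i : (sgval j * a^-1) ^+ i.+1 * sgval w * a ^+ i.+1
  = sgval j * ((sgval j * a^-1) ^+ i * sgval w * a ^+ i) ^ a.
Proof. by rewrite conjgE expgS expgSr !mulgA. Qed.

Lemma mem_expg_mulV (j w : V) i : (sgval j * a^-1) ^+ i * sgval w * a ^+ i \in W.
Proof.
elim: i => [|i IHi]; first by rewrite mul1g mulg1 subgP.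
by rewrite expg_mulV_S groupM ?memJ_norm ?subgP.
Qed.

(** On the last coordinate [shift] acts by [w |-> j * w ^ a = (j * a^-1) * w * a], so its iterates
    have this closed form. *)
Lemma iter_shift_snd i j w : iter i shift (1, j, w) =
  (1, j, subg W ((sgval j * a^-1) ^+ i * sgval w * a ^+ i)).
Proof.
elim: i => [|i IHi]; first by rewrite mul1g mulg1 sgvalK.
rewrite iterS IHi /shift /= mulg1; congr (_, _, _); apply: val_inj => /=.
by rewrite sgval_conj_a !subgK ?mem_expg_mulV // expg_mulV_S.
Qed.

Lemma diff1E j k w : diff 1 (j, k, w) = (1, j, k * (w^-1 * conj_a w)).
Proof.
rewrite /diff /shift /=; congr (_, _, _); first exact: mulVg.
  exact: mulKg.
by rewrite [LHS]mulgA (subg_mulC w^-1) -mulgA.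
Qed.

Lemma sgval_mul_conj_a (j w : V) :
  sgval (j * conj_a w) = sgval w * (sgval j * [~ sgval w, a]).
Proof.
rewrite /= sgval_conj_a conjg_mulR; move: [~ _, a] => d.
have := congr1 sgval (subg_mulC j w); rewrite /= => E.
by rewrite !mulgA E.
Qed.

(** With [N = T - 1], the fixed points of [T] form the kernel of [N], and [N2 u] is the only
    nontrivial coordinate of [N (N u)]. *)
Lemma shift_diff1 u : shift (diff 1 u) = diff 1 u <-> N2 u = 1.
Proof.
case: u => [[j k] w]; rewrite diff1E /N2 /shift /=.
set n := k * (w^-1 * conj_a w).
have def_n: sgval n = sgval k * [~ sgval w, a] by rewrite /= sgval_conj_a.
have Wwa: [~ sgval w, a] \in W by rewrite commgEl groupM ?groupV ?memJ_norm ?subgP.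
have -> : [~ sgval k, a] = [~ sgval n, a].
  rewrite def_n commMgJ (conjg_commute (cWa (subgP k) Wwa).1).
  have /commgP/eqP -> := (cWa (subgP w) Wwa).2.
  by rewrite mulg1.
have fixn := sgval_mul_conj_a j n.
split=> [E|E].
  apply: (mulgI (sgval n)); rewrite mulg1 -fixn.
  by have /(congr1 (fun u : V3 => sgval u.2)) := E.
by rewrite mulg1; congr (_, _, _); apply: val_inj; rewrite [LHS]fixn E mulg1.
Qed.

Variable G : {group gT}.
Hypotheses (defG : W <*> <[a]> = G) (tiWa : W :&: <[a]> = 1).
(** By [iter_shift_snd], [exp_a] makes the [i]-th iterate of [shift] fix every [(1, j, w)] when
    [a ^+ i = 1], and [ord_b] gives [a ^+ i = 1] once it fixes [(1, b, 1)]. *)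
Hypothesis exp_a : forall g i, g \in W -> a ^+ i = 1 -> (g * a^-1) ^+ i = 1.
Hypothesis ord_b : forall i, (b * a^-1) ^+ i * a ^+ i = 1 -> a ^+ i = 1.

Lemma N2_W u : N2 u \in W.
Proof.
by rewrite groupM ?subgP // commgEl groupM ?groupV ?memJ_norm ?subgP.
Qed.

Lemma snd_elt i u : (shift_elt ^+ i * trans_elt u).2 = a ^+ i * N2 u.
Proof.
rewrite /=; congr (_ * _); elim: i => [|i IHi] //.
by rewrite !expgS /= IHi.
Qed.

Let central h := forall h', h' \in H -> commute h h'.

Lemma shift_elt_H : shift_elt \in H. Proof. by rewrite mem_gen // inE cycle_id. Qed.

Lemma trans_elt_H u : trans_elt u \in H.
Proof. by rewrite mem_gen // inE trans_elt_M orbT. Qed.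

Lemma central_diff i u : shift (diff i u) = diff i u ->
  central [~ trans_elt u, shift_elt ^+ i].
Proof. by move=> fix_u h Hh; rewrite comm_trans_iter; apply: trans_central. Qed.

Lemma central_trans u h : N2 u = 1 -> h \in H -> central [~ trans_elt u, h].
Proof.
move/shift_diff1 => fix_u /memHP[i [v ->]]; rewrite commgMJ.
have /commgP/eqP -> := trans_comm u v; rewrite mul1g.
have cX : central [~ trans_elt u, shift_elt ^+ i].
  by apply/central_diff/shift_diff; elim: i => //= i ->.
by rewrite (conjg_commute (cX _ (trans_elt_H v))).
Qed.

(** The [i]-th iterate of [shift] fixes all of [diff 1 v], so by [shift_diff] every [diff i v] is
    fixed by [shift], hence central. *)
Lemma central_shift i h : a ^+ i = 1 -> h \in H -> central [~ shift_elt ^+ i, h].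
Proof.
move=> ai1 /memHP[m [v ->]]; rewrite commgMJ.
have /commgP/eqP -> : commute (shift_elt ^+ i) (shift_elt ^+ m) by apply/commuteX2.
rewrite conj1g mulg1 -invgR => h' Hh'; apply/commute_sym/commuteV/commute_sym.
apply: central_diff Hh'; apply/shift_diff; case: v => [[j k] w].
rewrite diff1E iter_shift_snd exp_a ?subgP // ai1 mul1g mulg1.
by congr (_, _, _); apply: sgvalK.
Qed.

Lemma capable2_construction : capable 2 G.
Proof.
apply: (@capable2_morph _ _ [group of H] G snd) => //.
- move=> _ /memHP[i [u ->]]; rewrite -defG snd_elt.
  rewrite groupM ?groupX //; first by rewrite mem_gen // inE cycle_id orbT.
  by rewrite mem_gen // inE N2_W.
- move=> g; rewrite -defG joingC norm_joinEl ?cycle_subG //.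
  case/mulsgP=> _ w /cycleP[i ->] Ww ->.
  exists (shift_elt ^+ i * trans_elt (subg W w, 1, 1)).
    by rewrite groupM ?groupX ?shift_elt_H ?trans_elt_H.
  by rewrite snd_elt /N2 /= comm1g mulg1 subgK.
(* As [W] meets [<[a]>] trivially, [a ^+ i * N2 u = 1] makes both factors trivial, and each half of
   the element is then second central. *)
move=> _ /memHP[i [u ->]]; rewrite snd_elt; split=> [E|Z2].
  have ai1: a ^+ i = 1.
    apply/set1gP; rewrite -tiWa inE mem_cycle andbT.
    by rewrite -groupV (mulg1_eq E) N2_W.
  move: E; rewrite ai1 mul1g => N2u g g' Hg Hg'; apply/eqP/commgP.
  rewrite commMgJ; apply/commute_sym/commuteM; apply/commute_sym; last first.
    exact: central_trans Hg'.
  have cX := central_shift ai1 Hg.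
  by rewrite (conjg_commute (cX _ (trans_elt_H u))); apply: cX.
have cent_comm g : g \in H -> commute [~ shift_elt ^+ i * trans_elt u, g] shift_elt.
  by move=> Hg; apply/commgP/eqP/Z2 => //; apply: shift_elt_H.
have N2u : N2 u = 1.
  apply/shift_diff1/commute_shift; have := cent_comm _ shift_elt_H.
  rewrite commMgJ (_ : [~ _, _] = 1); last first.
    by apply/eqP/commgP/commute_sym/commuteX.
  by rewrite conj1g mul1g -(comm_trans_iter 1).
have ai1: a ^+ i = 1; last by rewrite ai1 mul1g.
(* This [y] has [diff 1 y = (1, b, 1)], the vector tested by [ord_b]. *)
apply: ord_b; pose y : V3 := (subg W b, 1, 1).
have : shift (diff i y) = diff i y.
  apply: commute_shift; have := cent_comm _ (trans_elt_H y).
  rewrite commMgJ.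
  have /commgP/eqP -> := trans_comm u y; rewrite mulg1.
  rewrite -(invgR (trans_elt y)) comm_trans_iter conjVg.
  rewrite (conjg_commute (trans_comm _ _)) => /commute_sym/commuteV/commute_sym.
  by rewrite invgK.
move/shift_diff; rewrite diff1E (_ : 1 * _ = 1); last first.
  by apply: val_inj; rewrite /= sgval_conj_a conj1g invg1 !mulg1.
rewrite iter_shift_snd => /(congr1 (fun u : V3 => sgval u.2)).
by move: (mem_expg_mulV (subg W b) 1 i); rewrite /= => /subgK ->; rewrite subgK // mulg1.
Qed.

End Construction.

(** * Checking the construction for the listed groups *)

Lemma relations_capable p e (gT : finGroupType) (G : {group gT}) (a b : gT) :
    prime p -> odd p -> exponents_ok e -> <<[set a; b]>> = G ->
    sat_relations p e a b -> #|G| = (p ^ (ealpha e + ebeta e + egamma e))%N ->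
  capable 2 G.
Proof.
move=> p_pr p_odd /and5P[leBA leCB C_gt0 /eqP eqAS leSC] genG rel_ab oG.
have p_gt1 := prime_gt1 p_pr; rewrite -genG in oG.
have [aA bB cC cca ccb] := rel_ab.
set c := [~ a, b] in bB cC cca ccb.
have Ga: a \in G by rewrite -genG mem_gen ?set21.
have Gb: b \in G by rewrite -genG mem_gen ?set22.
have cGc: c \in 'C(G) by rewrite -genG (relations_comm_center rel_ab).
have cc g : g \in G -> commute c g by move/(centP cGc).
have defG1: G^`(1) = <[c]> by rewrite -genG (relations_der1 rel_ab).
have sGZ: G^`(1) \subset 'Z(G).
  by rewrite subsetI der_sub defG1 cycle_subG.
have [oc oW] := exact_relations_card p_gt1 rel_ab oG.
rewrite -orderE -/c in oc.
pose W := (<[c]> <*> <[b]>)%G.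
have nWG: G \subset 'N(W) by rewrite -genG (relations_norm_W rel_ab).
have defG: W <*> <[a]> = G by rewrite -genG -(relations_gen_W a b).
have sWG: W \subset G by rewrite -defG joing_subl.
have oddA: odd (p ^ ealpha e) by rewrite oddX p_odd orbT.
have expa i : a ^+ i = 1 -> p ^ ealpha e %| i.
  by move=> ai1; apply: (exact_relations_expg p_gt1 rel_ab oG); rewrite ai1 group1.
have bA: b ^+ (p ^ ealpha e) = 1.
  rewrite -(subnKC leBA) expnD expgnA bB -expgnA -expnD addnBA //.
  by rewrite addnC eqAS addnC addnK.
(* First [p ^ ebeta e] divides [i]; the order of [c] then forces a further factor
   [p ^ (egamma e - esigma e)], which completes [p ^ ealpha e]. *)
have expb i : b ^+ i = 1 -> p ^ ealpha e %| i.
  move=> bi1; have /dvdnP[k def_i]: p ^ ebeta e %| i.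
    by apply: (exact_relations_expg_b p_gt1 rel_ab oG); rewrite bi1 group1.
  move: bi1; rewrite def_i mulnC expgnA bB -expgnA => /eqP.
  rewrite -order_dvdn oc -{1}(subnKC leSC) expnD dvdn_pmul2l ?expn_gt0 ?(ltnW p_gt1) //.
  have -> : ealpha e = (ebeta e + (egamma e - esigma e))%N.
    by rewrite addnBA // -eqAS addnK.
  by rewrite expnD dvdn_pmul2l ?expn_gt0 ?(ltnW p_gt1).
have expW g : g \in W -> g ^+ (p ^ ealpha e) = 1.
  rewrite /W /= norm_joinEr; last first.
    by rewrite cycle_subG (subsetP (cent_sub _)) // cent_cycle; apply/cent1P/commute_sym/cc.
  case/mulsgP=> _ _ /cycleP[i ->] /cycleP[j ->] ->.
  rewrite expgMn; last by apply/commuteX2/cc.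
  rewrite expgnAC (expgnAC b) bA expg1n mulg1.
  rewrite -(subnKC (leq_trans leCB leBA)) expnD expgnA cC.
  by rewrite !expg1n.
apply: (@capable2_construction _ W a b) => //.
- exact: relations_abelian_W rel_ab.
- exact: subsetP nWG a Ga.
- by rewrite mem_gen // inE cycle_id orbT.
- move=> g h Wg Wh; have /cycleP[i ->]: [~ g, a] \in <[c]>.
    by rewrite -defG1 mem_commg // (subsetP sWG).
  have Gh := subsetP sWG h Wh.
  by split; apply/commute_sym/commuteX/commute_sym/cc.
- apply/trivgP/subsetP=> x /setIP[Wx /cycleP[i def_x]].
  rewrite inE def_x; move: Wx; rewrite def_x.
  move=> /(exact_relations_expg p_gt1 rel_ab oG)/dvdnP[k ->].
  by rewrite mulnC expgnA aA expg1n.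
- move=> g i Wg /expa/dvdnP[k ->]; rewrite mulnC expgnA.
  have Gg := subsetP sWG g Wg.
  have comm_c : [~ g, a^-1] \in <[c]> by rewrite -defG1 mem_commg ?groupV.
  rewrite (class2_expMn sGZ) ?groupV // ?(expW g Wg) ?expVgn ?aA ?invg1 ?mulg1 ?expg1n //.
  rewrite (dvdn_trans (order_dvdG comm_c)) // -orderE oc dvdn_exp2l //.
  exact: leq_trans leBA.
move=> i.
have c_Va: [~ a^-1, b] = c^-1 by rewrite commVg //; apply/commute_sym/cc.
rewrite expMg_Rmul ?c_Va; last 2 first.
- by apply/commuteV/commute_sym/cc; rewrite groupV.
- by apply/commuteV/commute_sym/cc.
rewrite expVgn -!mulgA.
have cCa : commute (c^-1 ^+ 'C(i, 2)) (a ^+ i).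
  by apply/commuteX2/commute_sym/commuteV/commute_sym/cc.
rewrite cCa mulKg expVgn => /divg1_eq bi.
(* Now [b ^+ i] is a power of the central [c], so it commutes with [a]. Hence the order of [c]
   divides [i] and, being odd, also ['C(i, 2)], which gives [b ^+ i = 1]. *)
have ci1: c ^+ i = 1.
  have <- : [~ a, b ^+ i] = c ^+ i by rewrite commgX //; apply/commute_sym/cc.
  by rewrite bi; apply/eqP/commgP/commuteX/commute_sym/cc.
have dvC: #[c] %| 'C(i, 2).
  by rewrite dvdn_bin2 ?order_dvdn ?ci1 // oc oddX p_odd orbT.
have /expb/dvdnP[k ->] : b ^+ i = 1.
  by rewrite bi; apply/eqP; rewrite -order_dvdn.
by rewrite mulnC expgnA aA expg1n.
Qed.

Theorem theoremB (p : nat) (gT : finGroupType) (G : {group gT})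
    (p_prime : prime p) (p_odd : odd p)
    (pG : (p.-group G)%g) (G_2gen : two_generated G)
    (G_class2 : nil_class G = 2) :
  capable 2 G <-> exists! m : member, admissible m /\ isog_member p G m.
Proof.
have p_gt1 := prime_gt1 p_prime.
split=> [capG|[m [[m_ok isoG] _]]]; last first.
  have [a [b [genG rel_ab oG]]] := (isog_memberP G p_gt1 m_ok).1 isoG.
  exact: relations_capable (admissible_exponents m_ok) genG rel_ab oG.
have sGZ: G^`(1) \subset 'Z(G) by rewrite -nil_class2 G_class2.
have ncG: ~~ abelian G by rewrite -nil_class1 G_class2.
have oddG: odd #|G| by apply: odd_pgroup_odd pG.
have eq_orders x y : <<[set x; y]>> = G -> #[x] = #[y].
  exact: capable2_order.
have [e [a [b [e_ok genG rel_ab oG]]]] :=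
  equal_orders_relations p_prime p_odd pG sGZ ncG eq_orders G_2gen.
have [m m_ok def_e] := exponents_member e_ok; rewrite -def_e in rel_ab oG.
have isoG: isog_member p G m by apply/isog_memberP => //; exists a, b.
exists m; split=> // n [n_ok isoGn].
exact: isog_member_inj p_gt1 m_ok n_ok isoG isoGn.
Qed.
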